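(* Let $\mathcal{G}$ be a connected undirected communication graph with $n\ge 2$ nodes, with $D$ and $D_{\mathrm{avg}}$ the depth and average depth of the rooted spanning tree generated from $\mathcal{G}$ by the breadth-first tree construction. Suppose the smoothness assumption and the stochastic-oracle assumption hold, let $\Delta_f:=f(x^{(0)})-f^\star>0$ and $H_0:=\frac1n\sum_{i=1}^n\|\nabla f_i(x^{(0)})\|^2$, and fix an integer $B\ge1$. At each stochastic-gradient evaluation in Tree-RGT, every agent $i$ independently draws a mini-batch $\boldsymbol\xi_i=(\xi_{i,1},\dots,\xi_{i,B})$ from its local oracle and replaces $g_i(x,\xi_i)$ with the estimator $$g_{i,B}(x,\boldsymbol\xi_i):=\frac1B\sum_{b=1}^B g_i(x,\xi_{i,b}).$$ For any integer $T\ge1$, choose $$\gamma_B=\min\left\{\frac{\sqrt{B\Delta_f}}{\sqrt{nTL\sigma^2}},\ \frac{1}{40nDL}\right\}$$ as the stepsize. Then the root trajectory satisfies $$\frac1T\sum_{t=0}^{T-1}\mathbb{E}\|\nabla f(x_1^{(t)})\|^2\le\frac{60\sqrt{\Delta_f L\sigma^2}}{\sqrt{nBT}}+\frac{400D\Delta_f L}{T}+\frac{50D_{\mathrm{avg}}H_0}{T}.$$ Consequently, for any $\varepsilon>0$, it suffices to take $$T=\left\lceil\frac{14400\Delta_f L\sigma^2}{nB\varepsilon^4}+\frac{800D\Delta_f L+100D_{\mathrm{avg}}H_0}{\varepsilon^2}\right\rceil$$ to guarantee $\frac1T\sum_{t=0}^{T-1}\mathbb{E}\|\nabla f(x_1^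{(t)})\|^2\le\varepsilon^2$.
   Context: Problem: $f=\frac1n\sum_{i=1}^n f_i$, $f_i:\mathbb{R}^p\to\mathbb{R}$, agent $i\in\mathcal{N}=\{1,\dots,n\}$ holding $f_i$. Smoothness assumption: each $f_i$ is continuously differentiable with $L$-Lipschitz gradient, and $f^\star:=\inf_x f(x)>-\infty$. Stochastic-oracle assumption: all samples drawn, at different agents, times and (within mini-batches) oracle calls, are mutually independent with agent $i$'s samples distributed as $\mathcal{D}_i$; for every $i$ and $x$, $\mathbb{E}_{\xi_i\sim\mathcal{D}_i}[g_i(x,\xi_i)]=\nabla f_i(x)$ and $\mathbb{E}_{\xi_i\sim\mathcal{D}_i}\|g_i(x,\xi_i)-\nabla f_i(x)\|^2\le\sigma^2$, for some $\sigma^2>0$. Tree construction: node $1$ is the prescribed root. Level-synchronous breadth-first search: $h_1=0$, $p(1)=1$; for $\ell=0,\dots,n-2$, every node with $h_i=\ell$ sends a message to all its neighbors in $\mathcal{G}$, and every not-yet-discovered node $j$ receiving at least one message takes the smallest-index sender as its parent $p(j)$ and sets $h_j=\ell+1$. Let $\mathrm{Ch}(i)=\{j\in\mathcal{N}:p(j)=i\}$ (so $1\in\mathrm{Ch}(1)$). The links $\{i,p(i)\}$, $i\ne1$, form a spanning tree of $\mathcal{G}$, and $h_i$ is the distance from $1$ to $i$ in it. Set $D:=\max_i h_i$ and $D_{\mathrm{avg}}:=\frac1n\sum_i h_i$. Tree-RGT (single-sample form): given $x^{(0)}\in\mathbb{R}^p$ and stepsize $\gamma>0$, set $x_i^{(0)}=x^{(0)}$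 and $y_i^{(0)}=g_i(x_i^{(0)},\xi_i^{(0)})$ for all $i$. For $t=0,1,\dots$, with fresh samples $\xi_i^{(t+1)}$, $$x_1^{(t+1)}=x_1^{(t)}-\gamma y_1^{(t)},\qquad x_i^{(t+1)}=x_{p(i)}^{(t)}\ (i\ne1),$$ $$y_i^{(t+1)}=\sum_{j\in\mathrm{Ch}(i)}y_j^{(t)}+g_i(x_i^{(t+1)},\xi_i^{(t+1)})-g_i(x_i^{(t)},\xi_i^{(t)})\quad(i\in\mathcal{N}).$$ (The stochastic gradient subtracted is the one evaluated at the previous step.) Expectations are over all randomness; $\|\cdot\|$ is Euclidean. *)

(* Defs.v *)
From mathcomp Require Import all_boot all_order all_algebra.
From mathcomp Require Import all_classical all_reals all_analysis.
Export numFieldNormedType.Exports.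

Set Implicit Arguments.
Unset Strict Implicit.
Unset Printing Implicit Defensive.

Import Order.TTheory GRing.Theory Num.Theory.

Local Open Scope classical_set_scope.
Local Open Scope ring_scope.

(* The library norm `|v| on 'rV is the sup norm, hence a separate Euclidean
   norm. *)
Definition enorm (R : realType) (p : nat) (v : 'rV[R]_p) : R :=
  Num.sqrt (\sum_j v 0 j ^+ 2).

(* Row vector of partial derivatives; it represents the differential only where
   F is differentiable. *)
Definition grad (R : realType) (p : nat) (F : 'rV[R]_p -> R) (x : 'rV[R]_p) :
  'rV[R]_p := \row_j 'D_(delta_mx 0 j) F x.

Definition Lsmooth (R : realType) (p : nat) (L : R) (F : 'rV[R]_p -> R) : Prop :=
  [/\ forall x, differentiable F x,
      continuous (grad F) &
      forall x y, enorm (grad F x - grad F y) <= L * enorm (x - y)].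

Definition avg_fun (R : realType) (p n : nat) (f : 'I_n -> 'rV[R]_p -> R)
  (x : 'rV[R]_p) : R := n%:R^-1 * \sum_i f i x.

Notation borel_rV R p := (g_sigma_algebraType (@open 'rV[R]_p)).

(* A stochastic gradient oracle [g] for [F], with samples distributed as [D]:
   unbiased, with variance at most sigma^2. Joint measurability is what makes
   [g (X omega) (xi omega)] a random vector for random [X] and [xi]. The
   expectation of a vector is taken coordinatewise. *)
Definition stochastic_oracle (R : realType) (p : nat) (d : measure_display)
    (S : measurableType d) (D : probability S R) (sigma : R)
    (F : 'rV[R]_p -> R) (g : 'rV[R]_p -> S -> 'rV[R]_p) : Prop :=
  [/\ forall j, measurable_fun [set: (borel_rV R p * S)%type]
        (fun z : borel_rV R p * S => g z.1 z.2 0 j),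
      forall x j, D.-integrable [set: S] (fun s => (g x s 0 j)%:E),
      forall x j, ('E_D[fun s => (g x s 0 j)%R] = (grad F x 0 j)%:E)%E &
      forall x, ('E_D[fun s => (enorm (g x s - grad F x) ^+ 2)%R] <=
                 (sigma ^+ 2)%:E)%E].

Definition mutually_independent (R : realType) (d : measure_display)
    (Omega : measurableType d) (P : probability Omega R) (I : choiceType)
    (dS : I -> measure_display) (S : forall k, measurableType (dS k))
    (X : forall k, Omega -> S k) : Prop :=
  forall (s : seq I) (A : forall k, set (S k)),
    uniq s -> (forall k, measurable (A k)) ->
    P (\bigcap_(k in [set` s]) (X k @^-1` A k)) =
    (\prod_(k <- s) P (X k @^-1` A k))%E.

(* Level-synchronous breadth-first search. [bfs G root l j] is the status of
   node j after l rounds: [Some (h_j, p(j))] once it has been discovered, [None]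
   before. In round l the senders are the nodes of depth l, and an undiscovered
   node with a sending neighbor takes the smallest such neighbor as parent. *)
Section Bfs.
Variables (n : nat) (G : rel 'I_n) (root : 'I_n).

Definition sender (st : 'I_n -> option (nat * 'I_n)) (l : nat) (j k : 'I_n) :=
  (omap fst (st k) == Some l) && G k j.

Fixpoint bfs (l : nat) : 'I_n -> option (nat * 'I_n) :=
  if l is l'.+1 then fun j =>
    if bfs l' j is Some hp then Some hp else
    if [pick k | sender (bfs l') l' j k &
                 [forall k', sender (bfs l') l' j k' ==> (k <= k')%N]] is Some k
    then Some (l'.+1, k) else None
  else fun j => if j == root then Some (0%N, root) else None.

(* The rounds are 0, ..., n - 2, so there are n - 1 of them. On a connected
   graph every node is discovered, and the default values are never used. *)
Definition depth (i : 'I_n) : nat := if bfs n.-1 i is Some (h, _) then h else 0%N.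
Definition parent (i : 'I_n) : 'I_n :=
  if bfs n.-1 i is Some (_, k) then k else root.

Definition children (i : 'I_n) : {set 'I_n} := [set j | parent j == i].

Definition max_depth : nat := (\max_i depth i)%N.
Definition avg_depth (R : realType) : R := n%:R^-1 * \sum_i (depth i)%:R.

End Bfs.

(* Tree-RGT along one realization [xi] of the samples; the result at time t is
   the pair of families (x_i^(t))_i and (y_i^(t))_i. *)
Section TreeRGT.
Variables (R : realType) (p n : nat) (G : rel 'I_n) (root : 'I_n).
Variables (S : 'I_n -> Type) (g : forall i, 'rV[R]_p -> S i -> 'rV[R]_p).
Variables (gamma : R) (x0 : 'rV[R]_p) (xi : forall i, nat -> S i).

Fixpoint tree_rgt (t : nat) : ('I_n -> 'rV[R]_p) * ('I_n -> 'rV[R]_p) :=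
  if t is t'.+1 then
    let: (x, y) := tree_rgt t' in
    let x' i :=
      if i == root then x root - gamma *: y root else x (parent G root i) in
    let y' i :=
      \sum_(j in children G root i) y j + g (x' i) (xi i t) -
      g (x i) (xi i t') in
    (x', y')
  else (fun=> x0, fun i => g x0 (xi i 0%N)).

End TreeRGT.

Definition minibatch (R : realType) (p n B : nat) (S : 'I_n -> Type)
    (g : forall i, 'rV[R]_p -> S i -> 'rV[R]_p)
    (i : 'I_n) (x : 'rV[R]_p) (xi : 'I_B -> S i) : 'rV[R]_p :=
  B%:R^-1 *: \sum_b g i x (xi b).

(* (1/T) sum_(t < T) E ||grad f (x_root^(t))||^2 for Tree-RGT run with the
   mini-batch estimator *)
Definition root_stationarity (R : realType) (p n B : nat) (G : rel 'I_n)
    (root : 'I_n) (f : 'I_n -> 'rV[R]_p -> R)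
    (dS : 'I_n -> measure_display) (S : forall i, measurableType (dS i))
    (g : forall i, 'rV[R]_p -> S i -> 'rV[R]_p)
    (d : measure_display) (Omega : measurableType d) (P : probability Omega R)
    (xi : forall i, nat -> 'I_B -> Omega -> S i)
    (x0 : 'rV[R]_p) (gamma : R) (T : nat) : \bar R :=
  let x_root t w :=
    (tree_rgt G root (@minibatch R p n B S g) gamma x0
       (fun i s b => xi i s b w) t).1 root in
  ((T%:R^-1)%:E *
   \sum_(0 <= t < T) 'E_P[fun w => (enorm (grad (avg_fun f) (x_root t w)) ^+ 2)%R])%E.

(* Main.v *)
From HB Require Import structures.
Require Import Defs.
From mathcomp Require Import all_boot all_order all_algebra.
From mathcomp Require Import all_classical all_reals all_analysis.
From mathcomp Require Import measurable_realfun.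
From mathcomp Require Import ring lra zify.

Set Implicit Arguments.
Unset Strict Implicit.
Unset Printing Implicit Defensive.

Import Order.TTheory GRing.Theory Num.Theory.

Local Open Scope classical_set_scope.
Local Open Scope ring_scope.

(** Seen from the root, Tree-RGT is stochastic gradient descent with delays.
    Iterates travel down the tree one level per round, so node i works at time t
    with the root iterate of time t - h_i. Gradient increments travel up at the
    same speed, and telescope: the tracker of the root at time t is the sum,
    over the nodes with h_i <= t, of the stochastic gradients that they computed
    at time t - h_i, that is, at the root iterate of time t - 2 h_i
    ([tree_rgt_root_tracker]).

    Write v_t for the sum of the corresponding exact gradients and e_t for the
    noise. The descent lemma gains both n |grad f(x_t)|^2 and |v_t|^2 / n, up to
    the gap between v_t and n grad f(x_t). The gap has two sources. The iterates
    drift during 2 h_i steps; by smoothness and since the stepsize is at most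
    1 / (40 n D L), the part of the drift due to the v_s is absorbed by the gain
    in |v_t|^2, and the part due to the e_s remains. Besides, the nodes with
    h_i > t have not contributed yet; the number of those nodes sums over t to
    n Davg, which yields the term in Davg H0. All of this holds for every
    realization ([delayed_descent]).

    For the expectation, every sample enters the unrolled iteration once, at
    time t = s + h_i if agent i drew it at time s, and the iterates up to time t
    are functions of other samples. Hence its noise is centered given all the other
    samples, and is orthogonal to whatever they determine
    ([noise_orthogonal]). The terms linear in e_t vanish, and the variance of a
    sum of noises is the sum of their variances ([noise_sum_variance]), which
    for k consecutive steps gives k n sigma^2 / B. What is left is a bound
    Delta / (gamma n T) + Davg H0 / T + gamma L sigma^2 / B up to constants
    ([delayed_sgd_expectation]), and the prescribed stepsize balances its first
    and last terms ([stepsize_rate]). *)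

(** * The breadth-first tree *)

Section BfsTree.
Context (n : nat) (G : rel 'I_n) (root : 'I_n).
Local Open Scope nat_scope.

Notation bfs := (bfs G root).
Notation depth := (depth G root).
Notation parent := (parent G root).

Lemma bfs_le l m j hp : l <= m -> bfs l j = Some hp -> bfs m j = Some hp.
Proof.
move=> /subnKC <-; elim: (m - l) => [|k IH] lj; first by rewrite addn0.
by rewrite addnS /= IH.
Qed.

Lemma bfs_root l : bfs l root = Some (0, root).
Proof. by apply: (bfs_le (leq0n l)); rewrite /= eqxx. Qed.

Lemma bfs_depth_le l j h k : bfs l j = Some (h, k) -> h <= l.
Proof.
elim: l => [|l IH] /=; first by case: ifP => // _ [<-].
case E : (bfs l j) => [hp|]; first by rewrite E in IH => /IH/leqW.
by case: pickP => // k' _ [<-].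
Qed.

Lemma bfs_parent l j h k : j != root -> bfs l j = Some (h, k) ->
  exists h' k', h = h'.+1 /\ bfs l k = Some (h', k').
Proof.
move=> jr; elim: l => [|l IH] /=; first by rewrite (negbTE jr).
case E : (bfs l j) => [hp|].
  rewrite E in IH => /IH[h' [k' [-> kE]]]; exists h', k'.
  by rewrite kE.
case: pickP => // k0 /andP[/andP[/eqP sk0 _] _] [<- <-].
by case: (bfs l k0) sk0 => // -[h' k'] [->]; exists l, k'.
Qed.

Lemma bfs_neighbor l k h q j : bfs l k = Some (h, q) -> h < l -> G k j ->
  bfs l j != None.
Proof.
elim: l => // l IH /=; rewrite ltnS => kE hl Gkj.
case jE : (bfs l j) => [//|]; move: kE.
case E : (bfs l k) => [hp|]; last first.
  by case: pickP => // k' _ [hE _]; rewrite -hE ltnn in hl.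
move=> [hpE]; rewrite hpE in E.
move: hl; rewrite leq_eqVlt => /predU1P[hE|hl]; last first.
  by move: (IH E hl Gkj); rewrite jE.
have sk : sender G (bfs l) l j k by rewrite /sender E hE eqxx.
case: pickP => // /(_ [arg min_(i < k | sender G (bfs l) l j i) (i : nat)]).
case: arg_minnP => // i -> imin /=.
by move=> /negbT/negP[]; apply/forallP => i'; apply/implyP => /imin.
Qed.

Hypothesis Gconn : forall i j, connect G i j.

Let found l : {set 'I_n} := [set j | bfs l j != None].

(** A path from the root to an undiscovered node leaves the discovered set, and
    the first node outside is discovered in the next round. So every round
    discovers a node until none is missing, and n - 1 rounds suffice. *)
Let found_grows l : (l < #|found l|) || (found l == [set: 'I_n]%SET).
Proof.
elim: l => [|l /orP[IH|/eqP IH]].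
- by apply/orP; left; apply/card_gt0P; exists root; rewrite inE bfs_root.
- have foundS : found l \subset found l.+1.
    apply/fintype.subsetP => j; rewrite !inE.
    by case E : (bfs l j) => [hp|] // _; rewrite (bfs_le (leqnSn l) E).
  have [->|/eqP nfound] := eqVneq (found l.+1) [set: 'I_n]%SET; first by rewrite orbT.
  rewrite orbF; apply: leq_ltn_trans IH _; apply: proper_card.
  rewrite finset.properEneq foundS andbT; apply/eqP => foundE.
  apply: nfound; apply/finset.setP => j; rewrite finset.in_setT.
  have : root \in found l.+1 by rewrite inE bfs_root.
  have /connectP[s] := Gconn root j.
  elim: s root => [|x s IHs] r /=; first by move=> _ ->.
  move=> /andP[Grx sx] jE rf; apply: IHs sx jE _.
  have {rf} : r \in found l by rewrite foundE.
  rewrite !inE; case E : (bfs l r) => [[h q]|] // _.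
  apply: bfs_neighbor (bfs_le (leqnSn l) E) _ Grx.
  by rewrite ltnS; exact: bfs_depth_le E.
- apply/orP; right; rewrite -finset.subTset -IH; apply/fintype.subsetP => j; rewrite !inE.
  by case E : (bfs l j) => [hp|] // _; rewrite (bfs_le (leqnSn l) E).
Qed.

Lemma bfs_found j : exists h k, bfs n.-1 j = Some (h, k).
Proof.
have : j \in found n.-1.
  have /orP[|/eqP ->] := found_grows n.-1; last by rewrite finset.in_setT.
  rewrite prednK ?(leq_ltn_trans _ (ltn_ord root))// => h.
  have /eqP -> : found n.-1 == [set: 'I_n]%SET by rewrite eqEcard finset.subsetT cardsT card_ord.
  by rewrite finset.in_setT.
by rewrite inE; case: (bfs n.-1 j) => // -[h k] _; exists h, k.
Qed.

Lemma depth_root : depth root = 0.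
Proof. by rewrite /Defs.depth bfs_root. Qed.

Lemma parent_root : parent root = root.
Proof. by rewrite /Defs.parent bfs_root. Qed.

Lemma depth_parent j : j != root -> depth j = (depth (parent j)).+1.
Proof.
move=> jr; have [h [k jE]] := bfs_found j.
have [h' [k' [hE kE]]] := bfs_parent jr jE.
by rewrite /Defs.depth /Defs.parent jE kE hE.
Qed.

Lemma max_depth_gt0 : 1 < n -> 0 < max_depth G root.
Proof.
move=> n1; have [j jr] : exists j, j != root.
  apply/existsP; rewrite -negb_forall; apply/negP => /forallP all_root.
  have : #|[set: 'I_n]%SET| <= #|[set root]%SET|.
    by apply/subset_leq_card/fintype.subsetP => j _; rewrite inE; exact: all_root.
  by rewrite cardsT card_ord cards1 leqNgt n1.
apply: leq_trans (leq_bigmax j); by rewrite -/(depth j) depth_parent.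
Qed.

Lemma depth_le_max j : depth j <= max_depth G root.
Proof. exact: leq_bigmax. Qed.

Lemma depth_eq0 j : (depth j == 0) = (j == root).
Proof.
apply/eqP/eqP => [|->]; last exact: depth_root.
by have [->//|jr] := eqVneq j root; rewrite depth_parent.
Qed.

Lemma parent_children i j : (j \in children G root i) = (parent j == i).
Proof. by rewrite inE. Qed.

End BfsTree.

(** * Unrolling Tree-RGT into delayed gradient steps *)

Section Unroll.
Context (R : realType) (p n : nat) (G : rel 'I_n) (root : 'I_n).
Hypothesis Gconn : forall i j, connect G i j.
Context (S : 'I_n -> Type) (g : forall i, 'rV[R]_p -> S i -> 'rV[R]_p).
Variables (gamma : R) (x0 : 'rV[R]_p) (xi : forall i, nat -> S i).

Notation depth := (depth G root).
Notation parent := (parent G root).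
Let x t := (tree_rgt G root g gamma x0 xi t).1.
Let y t := (tree_rgt G root g gamma x0 xi t).2.
Let grd t i := g (x t i) (xi i t).

Let xS t i : x t.+1 i =
  if i == root then x t root - gamma *: y t root else x t (parent i).
Proof. by rewrite /x /y /=; case: tree_rgt. Qed.

Let yS t i : y t.+1 i =
  \sum_(j in children G root i) y t j + grd t.+1 i - grd t i.
Proof. by rewrite /grd /x /y /=; case: tree_rgt. Qed.

(** Each round copies the iterate of the parent, which is one level higher. *)
Lemma tree_rgt_delay t i : x t i = x (t - depth i) root.
Proof.
elim: t i => [|t IH] i //.
have [->|ir] := eqVneq i root; first by rewrite depth_root subn0.
by rewrite xS (negbTE ir) IH (depth_parent Gconn ir) subSS.
Qed.

(** The recursion for y closes up on sums over a level: the children of the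
    nodes of level l are the nodes of level l + 1, plus the root if l = 0. *)
Let level_y (l t : nat) : 'rV[R]_p := \sum_(i | depth i == l) y t i.
Let level_grd (l t : nat) : 'rV[R]_p := \sum_(i | depth i == l) grd t i.

Let level_children l t :
  \sum_(i | depth i == l) \sum_(j in children G root i) y t j =
  (if l == 0%N then level_y 0 t else 0) + level_y l.+1 t.
Proof.
transitivity (\sum_(j | depth (parent j) == l) y t j).
  rewrite [RHS](partition_big parent (fun i => depth i == l))//=.
  apply: eq_bigr => i /eqP il; apply: eq_bigl => j; rewrite parent_children.
  by case: eqP => [->|]; rewrite ?andbT ?andbF// il eqxx.
have dp j : (depth (parent j) == l) =
    (depth j == l.+1) || ((l == 0%N) && (depth j == 0%N)).
  have [->|jr] := eqVneq j root; first by rewrite parent_root !depth_root; case: l.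
  by rewrite (depth_parent Gconn jr) eqSS andbF orbF.
rewrite (bigID (fun j => depth j == l.+1))/= addrC /level_y; congr (_ + _).
  case: eqP => [l0|l0]; last first.
    rewrite big_pred0// => j; rewrite dp; case: (l =P 0%N) l0 => // _ _.
    by rewrite orbF andbN.
  by apply: eq_bigl => j; rewrite dp l0/=; case: (depth j) => [|[]].
by apply: eq_bigl => j; rewrite dp; case: (depth j == l.+1); rewrite ?andbF.
Qed.

(** The latest gradients of level l and below that can have reached level l at
    time t: one from k levels further down has delay k. *)
Let subtree_grd (l t : nat) : 'rV[R]_p :=
  \sum_(i | (l <= depth i <= l + t)%N) grd (t - (depth i - l)) i.

Let subtree_grd0 l : subtree_grd l 0 = level_grd l 0.
Proof.
rewrite /subtree_grd /level_grd.
rewrite (eq_bigl (fun i => depth i == l)); last first.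
  by move=> i; rewrite addn0 eqn_leq andbC.
by apply: eq_bigr => i _; rewrite sub0n.
Qed.

Let subtree_grdS l t :
  subtree_grd l t.+1 = level_grd l t.+1 + subtree_grd l.+1 t.
Proof.
rewrite /subtree_grd /level_grd (bigID (fun i => depth i == l))/=; congr (_ + _).
  apply: eq_big => [i|i /andP[_ /eqP ->]]; last by rewrite subnn subn0.
  by case: eqP => [->|]; rewrite ?andbF// leqnn leq_addr.
apply: eq_big => [i|i /andP[/andP[li _] il]]; first by lia.
by congr grd; lia.
Qed.

(** Below the root only increments are forwarded, so y on a level is the latest
    change of the delayed sum; the root, its own child, accumulates them. *)
Let level_y_subtree l t : level_y l.+1 t.+1 =
  subtree_grd l.+1 t.+1 - subtree_grd l.+1 t /\ level_y l.+1 0 = subtree_grd l.+1 0.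
Proof.
have lS k s : level_y k.+1 s.+1 =
    level_y k.+2 s + level_grd k.+1 s.+1 - level_grd k.+1 s.
  rewrite /level_y; under eq_bigr do rewrite yS.
  by rewrite sumrB big_split/= level_children add0r.
split; last by rewrite subtree_grd0.
elim: t l => [|t IH] l; rewrite lS subtree_grdS.
  by rewrite !subtree_grd0 [level_y _ 0]/level_y; congr (_ - _); exact: addrC.
by rewrite IH (subtree_grdS l.+1 t); apply/rowP => c; rewrite !mxE; ring.
Qed.

Let root_y_subtree t : level_y 0 t = subtree_grd 0 t.
Proof.
elim: t => [|t IH]; first by rewrite subtree_grd0.
rewrite {1}/level_y; under eq_bigr do rewrite yS.
rewrite sumrB big_split/= level_children/= IH subtree_grdS.
case: t {IH} => [|t].
  rewrite (level_y_subtree 0 0).2 !subtree_grd0; apply/rowP => c; rewrite !mxE; ring.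
rewrite (level_y_subtree 0 t).1 subtree_grdS.
by apply/rowP => c; rewrite !mxE; ring.
Qed.

(** The gradient of node i travels up for h_i rounds and was computed at a root
    iterate that had travelled down for h_i rounds, hence the double delay. *)
Lemma tree_rgt_root_tracker t : y t root =
  \sum_(i | (depth i <= t)%N)
    g (x (t - depth i - depth i) root) (xi i (t - depth i)).
Proof.
have -> : y t root = level_y 0 t.
  rewrite /level_y (big_pred1 root)// => i; exact: depth_eq0.
rewrite root_y_subtree /subtree_grd; apply: eq_big => // i _.
by rewrite subn0 /grd tree_rgt_delay.
Qed.

Lemma tree_rgt_root_step t : x t.+1 root = x t root - gamma *:
  \sum_(i | (depth i <= t)%N)
    g (x (t - depth i - depth i) root) (xi i (t - depth i)).
Proof. by rewrite xS eqxx tree_rgt_root_tracker. Qed.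

End Unroll.

(** * The Euclidean inner product *)

Section EuclideanVectors.
Context (R : realType) (p : nat).
Implicit Types u v w : 'rV[R]_p.

Definition dotp u v : R := \sum_j u 0 j * v 0 j.

Lemma dotpC u v : dotp u v = dotp v u.
Proof. by apply: eq_bigr => j _; rewrite mulrC. Qed.

Lemma dotpDl u v w : dotp (u + v) w = dotp u w + dotp v w.
Proof. by rewrite -big_split; apply: eq_bigr => j _; rewrite mxE mulrDl. Qed.

Lemma dotpZl a u v : dotp (a *: u) v = a * dotp u v.
Proof. by rewrite mulr_sumr; apply: eq_bigr => j _; rewrite mxE mulrA. Qed.

Lemma dotpNl u v : dotp (- u) v = - dotp u v.
Proof. by rewrite -scaleN1r dotpZl mulN1r. Qed.

Lemma dotpBl u v w : dotp (u - v) w = dotp u w - dotp v w.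
Proof. by rewrite dotpDl dotpNl. Qed.

Lemma dotp0l u : dotp 0 u = 0.
Proof. by rewrite -[0](scale0r 0) dotpZl mul0r. Qed.

Lemma dotpDr u v w : dotp u (v + w) = dotp u v + dotp u w.
Proof. by rewrite !(dotpC u) dotpDl. Qed.

Lemma dotpZr a u v : dotp u (a *: v) = a * dotp u v.
Proof. by rewrite !(dotpC u) dotpZl. Qed.

Lemma dotpNr u v : dotp u (- v) = - dotp u v.
Proof. by rewrite !(dotpC u) dotpNl. Qed.

Lemma dotpBr u v w : dotp u (v - w) = dotp u v - dotp u w.
Proof. by rewrite dotpDr dotpNr. Qed.

Lemma dotp_suml (I : Type) (r : seq I) (P : pred I) (F : I -> 'rV[R]_p) u :
  dotp (\sum_(i <- r | P i) F i) u = \sum_(i <- r | P i) dotp (F i) u.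
Proof.
elim/big_rec2: _ => [|i y x _ <-]; first by rewrite dotp0l.
by rewrite dotpDl.
Qed.

Lemma dotp_sumr (I : Type) (r : seq I) (P : pred I) (F : I -> 'rV[R]_p) u :
  dotp u (\sum_(i <- r | P i) F i) = \sum_(i <- r | P i) dotp u (F i).
Proof. by rewrite dotpC dotp_suml; apply: eq_bigr => i _; rewrite dotpC. Qed.

Lemma dotp_ge0 u : 0 <= dotp u u.
Proof. by apply: sumr_ge0 => j _; rewrite -expr2 sqr_ge0. Qed.

Lemma enorm_sqr u : enorm u ^+ 2 = dotp u u.
Proof.
rewrite sqr_sqrtr; first by apply: eq_bigr => j _; rewrite expr2.
by apply: sumr_ge0 => j _; exact: sqr_ge0.
Qed.

Lemma enorm_ge0 u : 0 <= enorm u.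
Proof. exact: sqrtr_ge0. Qed.

(** Expand the square of s u - v. *)
Lemma dotp_young (s : R) u v : 0 < s ->
  2 * dotp u v <= s * dotp u u + s^-1 * dotp v v.
Proof.
move=> s0; rewrite -subr_ge0.
have -> : s * dotp u u + s^-1 * dotp v v - 2 * dotp u v =
    s^-1 * dotp (s *: u - v) (s *: u - v).
  rewrite !(dotpBl, dotpBr, dotpZl, dotpZr) (dotpC v u).
  by field; rewrite gt_eqF.
by rewrite mulr_ge0 ?dotp_ge0// invr_ge0 ltW.
Qed.

Lemma dotpDD_le u v :
  dotp (u + v) (u + v) <= 2 * dotp u u + 2 * dotp v v.
Proof.
have := dotp_young u v (@ltr01 R).
by rewrite !(dotpDl, dotpDr) (dotpC v u); lra.
Qed.

Lemma dotp_sum_le (I : Type) (r : seq I) (P : pred I) (F : I -> 'rV[R]_p) :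
  dotp (\sum_(i <- r | P i) F i) (\sum_(i <- r | P i) F i) <=
  (count P r)%:R * \sum_(i <- r | P i) dotp (F i) (F i).
Proof.
elim: r => [|i r IH]; first by rewrite !big_nil dotp0l mulr0.
rewrite !big_cons /=; case: ifP => // _.
rewrite !(dotpDl, dotpDr) add1n -natr1.
set S := \sum_(_ <- _ | _) _ in IH *; set Q := \sum_(_ <- _ | _) _ in IH *.
have cross : 2 * dotp (F i) S <= (count P r)%:R * dotp (F i) (F i) + Q.
  rewrite /S /Q; elim: {S Q IH} r => [|j r IH].
    by rewrite !big_nil dotpC dotp0l /= mul0r addr0 mulr0.
  rewrite !big_cons /=; case: ifP => // _; rewrite dotpDr add1n -natr1.
  by have := dotp_young (F i) (F j) (@ltr01 R); lra.
by rewrite (dotpC S); lra.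
Qed.

End EuclideanVectors.

(** * Smooth functions *)

Section DescentLemma.
Context (R : realType) (p : nat).

Lemma diff_gradE (F : 'rV[R]_p -> R) (z d : 'rV[R]_p) : differentiable F z ->
  'd F z d = dotp (grad F z) d.
Proof.
move=> dF; rewrite [in LHS](row_sum_delta d) linear_sum; apply: eq_bigr => j _.
by rewrite linearZ /= mxE deriveE// mulrC.
Qed.

Lemma Lsmooth_dotp (L : R) (F : 'rV[R]_p -> R) : 0 < L -> Lsmooth L F ->
  forall x y, dotp (grad F x - grad F y) (grad F x - grad F y) <=
    L ^+ 2 * dotp (x - y) (x - y).
Proof.
move=> L0 [_ _ lip] x y.
rewrite -!enorm_sqr -exprMn ler_sqr ?nnegrE ?enorm_ge0//.
by rewrite mulr_ge0 ?enorm_ge0// ltW.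
Qed.

(** The mean value theorem on [0, 1] for F along the segment, minus the claimed
    upper bound: its derivative at t is
    <grad F (x + t d) - grad F x, d> - L t |d|^2, which Young's inequality with
    weight 1 / (L t) makes nonpositive. *)
Lemma descent_lemma (L : R) (F : 'rV[R]_p -> R) : 0 < L ->
  (forall x, differentiable F x) ->
  (forall x y, dotp (grad F x - grad F y) (grad F x - grad F y) <=
    L ^+ 2 * dotp (x - y) (x - y)) ->
  forall x y, F y <= F x + dotp (grad F x) (y - x) + L / 2 * dotp (y - x) (y - x).
Proof.
move=> L0 dF lipF x y; set d := y - x.
pose c : R -> 'rV[R]_p := fun t => x + t *: d.
pose psi t := F (c t) - t * dotp (grad F x) d - L / 2 * t ^+ 2 * dotp d d.
have dFc (t : R) : is_derive t (1 : R) (F \o c) (dotp (grad F (c t)) d).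
  have dc : is_diff t c (fun s => s *: d).
    have := is_diffD (is_diff_cst x t) (is_diff_scalel t d).
    by rewrite add0r.
  have := is_diff_comp dc (differentiableP (dF (c t))).
  move=> dd; split; first by apply: diff_derivable; exact: ex_diff.
  rewrite deriveE; last exact: ex_diff.
  by rewrite diff_val /= scale1r diff_gradE.
have dpsi (t : R) : is_derive t (1 : R) psi
    (dotp (grad F (c t)) d - dotp (grad F x) d - L * t * dotp d d).
  have -> : psi = (F \o c) - (dotp (grad F x) d \*: id) -
     ((L / 2 * dotp d d) \*: (id ^+ 2)).
    apply/funext => s; rewrite /psi !fctE /= /GRing.scale /=; ring.
  apply: is_derive_eq; rewrite /GRing.scale /= !mulr1; by field.
have psi_cont : {within `[0 : R, 1], continuous psi}.
  apply: continuous_subspaceT; move=> /= s; apply: differentiable_continuous.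
  by apply/derivable1_diffP; case: (dpsi s).
have [t0 t01] := @MVT R psi _ 0 1 ltr01 (fun s _ => dpsi s) psi_cont; move: t0 t01 => t t01.
have xd : x + d = y by rewrite /d addrC subrK.
rewrite subr0 mulr1 /psi /c scale0r addr0 scale1r xd mul0r expr0n/=.
have /andP[t0 _] : 0 < t < 1 by move: t01; rewrite in_itv.
rewrite -dotpBl => E.
suff : dotp (grad F (x + t *: d) - grad F x) d <= L * t * dotp d d by rewrite /d in E *; lra.
have Lt0 : 0 < L * t by rewrite mulr_gt0.
set u := grad F (x + t *: d) - grad F x.
have := dotp_young u d (s := (L * t)^-1); rewrite invr_gt0 invrK => /(_ Lt0) young.
have uL : dotp u u <= L ^+ 2 * (t * (t * dotp d d)).
  apply: le_trans (lipF _ _) _.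
  by rewrite (addrC x) addrK dotpZl dotpZr.
have : (L * t)^-1 * dotp u u <= L * t * dotp d d.
  rewrite ler_pdivrMl//; apply: le_trans uL _.
  by rewrite le_eqVlt; apply/orP; left; apply/eqP; ring.
lra.
Qed.

Context (n : nat) (f : 'I_n -> 'rV[R]_p -> R) (L : R).
Hypotheses (L0 : 0 < L) (smf : forall i, Lsmooth L (f i)).

Lemma differentiable_avg_fun x : differentiable (avg_fun f) x.
Proof.
have -> : avg_fun f = n%:R^-1 *: (\sum_i f i).
  by apply/funext => z; rewrite fct_sumE.
apply: differentiableZ; apply: differentiable_sum => i.
by have [df _ _] := smf i; exact: df.
Qed.

Lemma grad_avg_fun x : grad (avg_fun f) x = n%:R^-1 *: \sum_i grad (f i) x.
Proof.
apply/rowP => j; rewrite !mxE summxE.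
have -> : avg_fun f = n%:R^-1 *: (\sum_i f i).
  by apply/funext => z; rewrite fct_sumE.
have df i : derivable (f i) x (delta_mx 0 j).
  by apply: diff_derivable; have [df _ _] := smf i; exact: df.
rewrite deriveZ; last exact: derivable_sum.
by rewrite derive_sum//; congr (_ *: _); apply: eq_bigr => i _; rewrite mxE.
Qed.

Lemma avg_fun_lipschitz x y :
  dotp (grad (avg_fun f) x - grad (avg_fun f) y)
       (grad (avg_fun f) x - grad (avg_fun f) y) <=
  L ^+ 2 * dotp (x - y) (x - y).
Proof.
rewrite !grad_avg_fun -scalerBr -sumrB dotpZl dotpZr.
case: n f smf => [|m] h smh.
  by rewrite big_ord0 dotp0l !mulr0 mulr_ge0 ?sqr_ge0 ?dotp_ge0.
rewrite mulrA -expr2 exprVn ler_pdivrMl ?exprn_gt0//.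
apply: le_trans (dotp_sum_le _ _ _) _.
rewrite count_predT -sum1_size sum_nat_const card_ord muln1 expr2 -mulrA ler_pM2l//.
apply: le_trans (ler_sum _ (fun i _ => Lsmooth_dotp L0 (smh i) x y)) _.
by rewrite sumr_const card_ord mulr_natl.
Qed.

Lemma descent_avg_fun x y :
  avg_fun f y <= avg_fun f x + dotp (grad (avg_fun f) x) (y - x) +
    L / 2 * dotp (y - x) (y - x).
Proof.
by apply: descent_lemma => //; [exact: differentiable_avg_fun|exact: avg_fun_lipschitz].
Qed.

End DescentLemma.

(** * Descent along delayed gradients *)

Section DelayedDescent.
Context (R : realType) (p n : nat).

(** Each time s lies in the window [t - k, t) for at most k values of t. *)
Lemma sum_window_le (a : nat -> R) (k T : nat) : (forall s, 0 <= a s) ->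
  \sum_(0 <= t < T) \sum_(t - k <= s < t) a s <= k%:R * \sum_(0 <= s < T) a s.
Proof.
move=> a0.
have -> : \sum_(0 <= t < T) \sum_(t - k <= s < t) a s =
    \sum_(0 <= t < T) \sum_(0 <= s < T | (t - k <= s)%N && (s < t)%N) a s.
  rewrite !big_nat; apply: eq_bigr => t /andP[_ tT].
  rewrite (big_nat_widenl _ 0)// (big_nat_widen _ _ T)//; exact: ltnW.
rewrite (exchange_big_dep_nat xpredT)//= mulr_sumr.
apply: ler_sum => s _; rewrite big_const_seq iter_addr addr0 -[leLHS]mulr_natl.
apply: ler_wpM2r => //; rewrite ler_nat -size_filter -[leqRHS](size_iota s.+1).
apply: uniq_leq_size => [|t]; first exact/filter_uniq/iota_uniq.
by rewrite mem_filter !mem_iota; lia.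
Qed.

(** Node i is deeper than t for the h_i values t < h_i. *)
Lemma sum_deeper_le (h : 'I_n -> nat) (T : nat) :
  \sum_(0 <= t < T) (count (fun i => (t < h i)%N) (enum 'I_n))%:R <=
  \sum_i (h i)%:R :> R.
Proof.
rewrite -!natr_sum ler_nat.
under eq_bigr => t _ do rewrite -sum1_count big_mkcond big_enum.
rewrite exchange_big; apply: leq_sum => i _ /=.
rewrite -big_mkcond sum1_count -size_filter -[leqRHS](size_iota 0).
apply: uniq_leq_size => [|t]; first exact/filter_uniq/iota_uniq.
by rewrite mem_filter !mem_iota; lia.
Qed.

Context (h : 'I_n -> nat) (D : nat) (F : 'rV[R]_p -> R).
Context (gF : 'rV[R]_p -> 'rV[R]_p) (gr : 'I_n -> 'rV[R]_p -> 'rV[R]_p).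
Context (L gamma low : R) (x e : nat -> 'rV[R]_p).
Hypotheses (n0 : (0 < n)%N) (D0 : (0 < D)%N) (hD : forall i, (h i <= D)%N).
Hypotheses (L0 : 0 < L) (gamma0 : 0 < gamma).
Hypothesis gamma_small : 40 * n%:R * D%:R * L * gamma <= 1.
Hypothesis gFE : forall z, gF z = n%:R^-1 *: \sum_i gr i z.
Hypothesis grL : forall i y z,
  dotp (gr i y - gr i z) (gr i y - gr i z) <= L ^+ 2 * dotp (y - z) (y - z).
Hypothesis F_descent : forall y z,
  F z <= F y + dotp (gF y) (z - y) + L / 2 * dotp (z - y) (z - y).
Hypothesis F_low : forall z, low <= F z.

Definition delayed_grad t : 'rV[R]_p :=
  \sum_(i | (h i <= t)%N) gr i (x (t - h i - h i)).
Notation v := delayed_grad.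

Hypothesis xS : forall t, x t.+1 = x t - gamma *: (v t + e t).

Let sq (u : 'rV[R]_p) := dotp u u.

(** The displacement over the last 2 h_i steps, split into gradients and noise.
    The sum of the noises is kept whole, because its variance will grow only
    linearly in the number of steps. *)
Let drift t i : sq (x (t - h i - h i) - x t) <=
  2 * gamma ^+ 2 * ((h i).*2%:R * \sum_(t - (h i).*2 <= s < t) sq (v s)) +
  2 * gamma ^+ 2 * sq (\sum_(t - (h i).*2 <= s < t) e s).
Proof.
rewrite -subnDA addnn; set a := (t - _)%N.
have at_ : (a <= t)%N := leq_subr _ _.
have -> : x a - x t = gamma *: (\sum_(a <= s < t) v s + \sum_(a <= s < t) e s).
  rewrite -big_split/= scaler_sumr.
  rewrite -opprB -(telescope_sumr x at_) -sumrN; apply: eq_bigr => s _; rewrite xS.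
  by rewrite addrAC subrr add0r opprK.
rewrite /sq dotpZl dotpZr mulrA -expr2.
apply: (@le_trans _ _ (gamma ^+ 2 * (2 * sq (\sum_(a <= s < t) v s) +
  2 * sq (\sum_(a <= s < t) e s)))).
  by rewrite ler_wpM2l ?sqr_ge0 ?dotpDD_le.
have : sq (\sum_(a <= s < t) v s) <= (h i).*2%:R * \sum_(a <= s < t) sq (v s).
  apply: le_trans (dotp_sum_le _ _ _) _.
  rewrite ler_wpM2r ?sumr_ge0// => [s _|]; first exact: dotp_ge0.
  by rewrite count_predT size_iota ler_nat /a; lia.
move=> /(ler_wpM2l (sqr_ge0 gamma)); rewrite /sq; lra.
Qed.

Let deeper t := (count (fun i => (t < h i)%N) (enum 'I_n))%:R : R.

(** A node deeper than t is charged its gradient at time 0: truncated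
    subtraction sets t - 2 h_i to 0 for it, so that its drift is the same
    expression as for the other nodes. *)
Let gradient_gap t : sq (v t - n%:R *: gF (x t)) <=
  2 * n%:R * L ^+ 2 * \sum_i sq (x (t - h i - h i) - x t) +
  2 * deeper t * \sum_i sq (gr i (x 0)).
Proof.
have -> : v t - n%:R *: gF (x t) =
    \sum_i (gr i (x (t - h i - h i)) - gr i (x t)) -
    \sum_(i | (t < h i)%N) gr i (x 0).
  rewrite gFE scalerA mulfV ?pnatr_eq0 -?lt0n// scale1r sumrB.
  rewrite [\sum_i gr i (x (_ - _ - _))](bigID (fun i => (h i <= t)%N))/=.
  have -> : \sum_(i | ~~ (h i <= t)%N) gr i (x (t - h i - h i)) =
      \sum_(i | (t < h i)%N) gr i (x 0).
    apply: eq_big => [i|i]; rewrite -ltnNge// => ti.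
    by congr (gr _ (x _)); lia.
  by rewrite addrAC addrK.
apply: le_trans (dotpDD_le _ _) _; rewrite dotpNl dotpNr opprK.
apply: lerD; rewrite -!mulrA ler_pM2l//.
  apply: le_trans (dotp_sum_le _ _ _) _.
  rewrite count_predT -sum1_size sum_nat_const card_ord muln1 ler_pM2l ?ltr0n//.
  by rewrite mulrA -expr2 mulr_sumr; apply: ler_sum => i _; exact: grL.
apply: le_trans (dotp_sum_le _ _ _) _.
rewrite /deeper enumT; apply: ler_wpM2l; first exact: ler0n.
rewrite big_mkcond; apply: ler_sum => i _; case: ifP => // _; exact: dotp_ge0.
Qed.

(** The descent lemma, with <n grad f, v> written as half of
    |n grad f|^2 + |v|^2 - |v - n grad f|^2. *)
Let step t : gamma * n%:R / 2 * sq (gF (x t)) + gamma / (2 * n%:R) * sq (v t) <=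
  F (x t) - F (x t.+1) + (dotp (L * gamma ^+ 2 *: v t - gamma *: gF (x t)) (e t) +
  L * gamma ^+ 2 / 2 * sq (e t)) + L * gamma ^+ 2 / 2 * sq (v t) +
  gamma / (2 * n%:R) * sq (v t - n%:R *: gF (x t)).
Proof.
have := F_descent (x t) (x t.+1).
have -> : x t.+1 - x t = - (gamma *: (v t + e t)) by rewrite xS addrAC subrr add0r.
rewrite /sq !(dotpBl, dotpBr, dotpZl, dotpZr, dotpNl, dotpNr, dotpDl, dotpDr).
rewrite (dotpC (v t) (gF _)) (dotpC (e t) (v t)).
have n0' : n%:R != 0 :> R by rewrite pnatr_eq0 -lt0n.
set A := F (x t); set B := F _; set gg := dotp (gF _) (gF _).
set gv := dotp (gF _) (v t); set ge := dotp (gF _) (e t).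
set vv := dotp (v t) (v t); set ve := dotp (v t) (e t); set ee := dotp (e t) (e t).
have -> : gamma / (2 * n%:R) * (vv - n%:R * gv + (- (n%:R * gv) - n%:R * - (n%:R * gg))) =
   gamma / (2 * n%:R) * vv - gamma * gv + gamma * n%:R / 2 * gg.
  by field.
lra.
Qed.

(** The gaps are summed over time, and the gradient part of the drift is
    absorbed by the gain in |v_t|^2. *)
Lemma delayed_descent (T : nat) :
  gamma * n%:R / 2 * \sum_(0 <= t < T) dotp (gF (x t)) (gF (x t)) <=
  F (x 0) - low +
  gamma / n%:R * (\sum_i (h i)%:R) * (\sum_i dotp (gr i (x 0)) (gr i (x 0))) +
  \sum_(0 <= t < T) (dotp (L * gamma ^+ 2 *: v t - gamma *: gF (x t)) (e t) +
    L * gamma ^+ 2 / 2 * dotp (e t) (e t)) +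
  2 * gamma ^+ 3 * L ^+ 2 * \sum_(0 <= t < T) \sum_i
    dotp (\sum_(t - (h i).*2 <= s < t) e s) (\sum_(t - (h i).*2 <= s < t) e s).
Proof.
rewrite -/(sq _).
have nR0 : 0 < n%:R :> R by rewrite ltr0n.
have DR1 : 1 <= D%:R :> R by rewrite ler1n.
set V := \sum_(0 <= t < T) sq (v t).
set W := \sum_(0 <= t < T) \sum_i sq (\sum_(t - (h i).*2 <= s < t) e s).
have V0 : 0 <= V by apply: sumr_ge0 => t _; exact: dotp_ge0.
pose Q := \sum_(0 <= t < T) \sum_i sq (x (t - h i - h i) - x t).
have Q_le : Q <= 8 * n%:R * D%:R ^+ 2 * gamma ^+ 2 * V + 2 * gamma ^+ 2 * W.
  apply: le_trans (ler_sum _ (fun t _ => ler_sum _ (fun i _ => drift t i))) _.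
  under eq_bigr do rewrite big_split /= -!mulr_sumr.
  rewrite big_split /= -!mulr_sumr lerD2r exchange_big /=.
  have -> : 8 * n%:R * D%:R ^+ 2 * gamma ^+ 2 * V =
    2 * gamma ^+ 2 * \sum_(i < n) (D.*2%:R * (D.*2%:R * V)).
    by rewrite sumr_const card_ord -mulr_natl -muln2 natrM; ring.
  rewrite ler_pM2l ?mulr_gt0 ?exprn_gt0//; apply: ler_sum => i _.
  rewrite -mulr_sumr.
  have hDi : (h i).*2%:R <= D.*2%:R :> R by rewrite ler_nat leq_double.
  apply: ler_pM => //; first by apply: sumr_ge0 => t _; apply: sumr_ge0 => s _; exact: dotp_ge0.
  apply: le_trans (sum_window_le _ _ _) _; first by move=> s; exact: dotp_ge0.
  by rewrite ler_wpM2r.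
have gap : \sum_(0 <= t < T) sq (v t - n%:R *: gF (x t)) <=
    2 * n%:R * L ^+ 2 * Q + 2 * (\sum_i (h i)%:R) * \sum_i sq (gr i (x 0)).
  apply: le_trans (ler_sum _ (fun t _ => gradient_gap t)) _.
  rewrite big_split /= -mulr_sumr -mulr_suml -mulr_sumr lerD2l.
  rewrite ler_wpM2r ?sumr_ge0// => [i _|]; first exact: dotp_ge0.
  by rewrite ler_pM2l// sum_deeper_le.
have := ler_sum (index_iota 0 T) (P := xpredT) (fun t _ => step t).
rewrite !big_split /= -!mulr_sumr -/V.
have -> : \sum_(0 <= t < T) F (x t) + \sum_(0 <= t < T) - F (x t.+1) = F (x 0) - F (x T).
  rewrite -big_split /= -opprB -(telescope_sumr (F \o x) (leq0n T)) -sumrN.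
  by apply: eq_bigr => t _; rewrite /= opprB.
set S1 := \sum_(0 <= t < T) sq (gF _); set S2 := \sum_(0 <= t < T) dotp _ _.
set S3 := \sum_(0 <= t < T) sq (e _); set S4 := \sum_(0 <= t < T) sq _.
set H := \sum_i (h i)%:R; set K := \sum_i dotp _ _ => main.
set q : R := n%:R * D%:R * L * gamma.
have q0 : 0 <= q by rewrite /q !mulr_ge0 ?ler0n// ltW.
have q40 : 40 * q <= 1 by rewrite /q; move: gamma_small; lra.
have c0 : 0 < gamma / (2 * n%:R) by rewrite divr_gt0// mulr_gt0.
have gap' : gamma / (2 * n%:R) * S4 <= gamma * L ^+ 2 * Q + gamma / n%:R * H * K.
  have -> : gamma * L ^+ 2 * Q + gamma / n%:R * H * K =
    gamma / (2 * n%:R) * (2 * n%:R * L ^+ 2 * Q + 2 * H * K).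
    by field; rewrite gt_eqF.
  by rewrite ler_pM2l.
have Q_le' : gamma * L ^+ 2 * Q <=
    8 * n%:R * D%:R ^+ 2 * gamma ^+ 3 * L ^+ 2 * V + 2 * gamma ^+ 3 * L ^+ 2 * W.
  have gL0 : 0 <= gamma * L ^+ 2 by rewrite mulr_ge0 ?sqr_ge0// ltW.
  by apply: le_trans (ler_wpM2l gL0 Q_le) _; rewrite le_eqVlt; apply/orP; left; apply/eqP; ring.
(* divided by gamma / (2 n), the coefficients on the left are at most q and
   16 q^2, and 1 / 40 + 16 / 1600 < 1 *)
have absorb : (L * gamma ^+ 2 / 2 + 8 * n%:R * D%:R ^+ 2 * gamma ^+ 3 * L ^+ 2) * V <=
    gamma / (2 * n%:R) * V.
  apply: ler_wpM2r => //.
  have -> : L * gamma ^+ 2 / 2 + 8 * n%:R * D%:R ^+ 2 * gamma ^+ 3 * L ^+ 2 =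
    gamma / (2 * n%:R) * (n%:R * L * gamma + 16 * q ^+ 2).
    by rewrite /q; field; rewrite gt_eqF.
  rewrite -[leRHS]mulr1 ler_pM2l//.
  have : n%:R * L * gamma <= q.
    rewrite /q -mulrA -[leRHS]mulrA -[leRHS]mulrA ler_pM2l// ler_peMl// mulr_ge0// ltW//.
  have : q ^+ 2 <= 40^-1 * q by rewrite expr2 ler_wpM2r//; lra.
  lra.
have := F_low (x T); lra.
Qed.

End DelayedDescent.

(** * Borel measurability of vectors *)

Section BorelVectors.
Context (R : realType) (p : nat) (d : measure_display) (T : measurableType d).

(** The rational boxes form a countable base of the topology, so the
    coordinates decide Borel measurability. *)
Lemma measurable_vec (X : T -> 'rV[R]_p) :
  (forall j, measurable_fun setT (fun w => X w 0 j)) ->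
  measurable_fun setT (X : T -> borel_rV R p).
Proof.
move=> mX.
apply: (@measurability _ _ T (borel_rV R p) setT X (@open 'rV[R]_p)) => // _ [U oU <-].
rewrite setTI.
pose box (ab : 'rV[rat]_p * 'rV[rat]_p) : set 'rV[R]_p :=
  [set x | forall j, ratr (ab.1 0 j) < x 0 j /\ x 0 j < ratr (ab.2 0 j)].
have -> : X @^-1` U = \bigcup_ab
    (if `[< box ab `<=` U >] then X @^-1` (box ab) else set0).
  apply/seteqP; split => w /=; last first.
    by move=> [ab _]; case: asboolP => // + /=; exact.
  move=> Uw; have [e e0 eU] : exists2 e : R, 0 < e & ball (X w) e `<=` U.
    by have /nbhs_ballP := open_nbhs_nbhs (conj oU Uw).
  have qa j : exists q : rat, X w 0 j - e < ratr q /\ ratr q < X w 0 j.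
    have /rat_in_itvoo[q] : X w 0 j - e < X w 0 j by rewrite ltrBlDr ltrDl.
    by rewrite in_itv => /andP[? ?]; exists q.
  have qb j : exists q : rat, X w 0 j < ratr q /\ ratr q < X w 0 j + e.
    have /rat_in_itvoo[q] : X w 0 j < X w 0 j + e by rewrite ltrDl.
    by rewrite in_itv => /andP[? ?]; exists q.
  have [a aE] := choice qa; have [b bE] := choice qb.
  exists (\row_j a j, \row_j b j) => //; case: asboolP => [_ j|[]] /=.
    by rewrite !mxE; have [_ ?] := aE j; have [? _] := bE j.
  move=> y ybox; apply: eU; split => // i j; rewrite (ord1 i).
  have [/=] := ybox j; rewrite !mxE /ball /= => ay yb.
  have [? _] := aE j; have [_ ?] := bE j.
  by rewrite ltr_distlC; apply/andP; split; lra.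
apply: countable_bigcupT_measurable => [|ab]; first exact: countableP.
case: asboolP => _ //.
have -> : X @^-1` (box ab) =
    \bigcap_(j in [set: 'I_p]) ((fun w => X w 0 j) @^-1`
      [set` `]ratr (ab.1 0 j), ratr (ab.2 0 j)[%R]).
  apply/seteqP; split => w /= H j; first by move=> _ /=; rewrite in_itv /=; apply/andP; exact: H.
  by have := H j I; rewrite /= in_itv /= => /andP.
apply: fin_bigcap_measurable => // j _; rewrite -[X in measurable X]setTI.
exact: mX.
Qed.

Lemma measurable_fun_continuous_vec (h : 'rV[R]_p -> R) (X : T -> 'rV[R]_p) :
  continuous h -> (forall j, measurable_fun setT (fun w => X w 0 j)) ->
  measurable_fun setT (fun w => h (X w)).
Proof.
move=> hc mX.
apply: (measurableT_comp (f := h : borel_rV R p -> R)); last exact: measurable_vec.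
apply: (measurability _ (RGenOpens.measurableE R)) => // _ [_ [a [b ->]] <-].
rewrite setTI; apply: sub_sigma_algebra.
by apply: open_comp => //; exact: interval_open.
Qed.

End BorelVectors.

(** * One sample given all the others *)

Section FreshSample.
Context (R : realType) (d : measure_display) (Omega : measurableType d).
Context (P : probability Omega R) (I : choiceType) (dS : I -> measure_display).
Context (S : forall k, measurableType (dS k)) (X : forall k, Omega -> S k).
Hypothesis mX : forall k, measurable_fun setT (X k).
Hypothesis indX : mutually_independent P X.
Context (Dist : forall k, probability (S k) R).
Hypothesis lawX : forall k A, measurable A -> P (X k @^-1` A) = Dist k A.

Definition other_cylinders (k : I) : set (set Omega) :=
  [set C | exists (s : seq I) (A : forall j, set (S j)),
    [/\ k \notin s, uniq s, forall j, measurable (A j) &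
        C = \bigcap_(j in [set` s]) X j @^-1` A j]].

(** The sample space with the sigma-algebra of all samples other than k. *)
Notation others k := (g_sigma_algebraType (other_cylinders k)).

Let cylinder_measurable k : other_cylinders k `<=` measurable.
Proof.
move=> _ [s [A [_ _ mA ->]]]; apply: fin_bigcap_measurable => // j _.
by rewrite -[X in measurable X]setTI; exact: mX.
Qed.

Lemma measurable_others k j : j != k ->
  measurable_fun setT (X j : others k -> S j).
Proof.
move=> jk _ B mB; rewrite setTI; apply: sub_sigma_algebra.
exists [:: j], (@dfwith I (fun j => set (S j)) (fun=> setT) j B); split => //.
- by rewrite inE eq_sym.
- by move=> i; case: dfwithP.
- by rewrite set_cons1 bigcap_set1 dfwithin.
Qed.

(** The identity map, named to be a random variable whose law is the restriction
    of P to the sigma-algebra of the other samples. *)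
Definition to_others k : Omega -> others k := id.

Lemma measurable_to_others k : measurable_fun setT (@to_others k).
Proof.
apply: (@measurability _ _ Omega (others k) setT _ (other_cylinders k)) => //.
by move=> _ [C Ck <-]; rewrite setTI; exact: cylinder_measurable Ck.
Qed.

HB.instance Definition _ k :=
  isMeasurableFun.Build _ _ _ _ (@to_others k) (@measurable_to_others k).

Lemma measurable_fun_others k d' (T' : measurableType d') (f : Omega -> T') :
  measurable_fun setT (f : others k -> T') -> measurable_fun setT f.
Proof. by move=> mf; exact: measurableT_comp mf (@measurable_to_others k). Qed.

Definition with_sample k (w : Omega) : others k * S k := (w, X k w).

Lemma measurable_with_sample k : measurable_fun setT (@with_sample k).
Proof. by apply/measurable_fun_pairP; split; [exact: measurable_to_others|exact: mX]. Qed.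

HB.instance Definition _ k :=
  isMeasurableFun.Build _ _ _ _ (@with_sample k) (@measurable_with_sample k).

Let cylinder_setI k : setI_closed (other_cylinders k).
Proof.
move=> _ _ [s1 [A1 [k1 _ mA1 ->]]] [s2 [A2 [k2 _ mA2 ->]]].
exists (undup (s1 ++ s2)), (fun j => (if j \in s1 then A1 j else setT) `&`
  (if j \in s2 then A2 j else setT)); split.
- by rewrite mem_undup mem_cat negb_or k1.
- exact: undup_uniq.
- by move=> j; apply: measurableI; case: ifP.
- apply/seteqP; split => w /=.
    by move=> [w1 w2] j _; split; case: ifP => // js; [exact: w1|exact: w2].
  move=> ws; split => j /= js; have := ws j;
    by rewrite /= mem_undup mem_cat js ?orbT => /(_ isT) [].
Qed.

Let cylinder_indep k C (B : set (S k)) : other_cylinders k C -> measurable B ->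
  P (C `&` X k @^-1` B) = (Dist k B * P C)%E.
Proof.
move=> [s [A [ks us mA ->]]] mB; pose A' := @dfwith I (fun j => set (S j)) A k B.
have mA' j : measurable (A' j) by rewrite /A'; case: dfwithP.
have A's j : j \in s -> A' j = A j.
  by move=> js; rewrite /A' dfwithout//; apply: contraNneq ks => ->.
have -> : (\bigcap_(j in [set` s]) X j @^-1` A j) `&` X k @^-1` B =
    \bigcap_(j in [set` k :: s]) X j @^-1` A' j.
  apply/seteqP; split => w /=.
    move=> [ws wk] j; rewrite /= inE => /predU1P[->|js].
      by rewrite /A' dfwithin.
    by rewrite A's//; exact: ws.
  move=> ws; split => [j js|].
    by rewrite -A's//; apply: ws; rewrite /= inE js orbT.
  by have := ws k; rewrite /= inE eqxx /A' dfwithin; exact.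
rewrite indX//= ?ks// big_cons indX// /A' dfwithin lawX//; congr (_ * _)%E.
by rewrite big_seq [RHS]big_seq; apply: eq_bigr => j /A's; rewrite /A' => ->.
Qed.

(** Both sides are finite measures in E, and they agree on the cylinders, which
    are stable under intersection. *)
Lemma others_indep k (E : set (others k)) (B : set (S k)) :
  measurable E -> measurable B ->
  P (E `&` X k @^-1` B) = (P E * Dist k B)%E.
Proof.
move=> mE mB.
have mXB : measurable (X k @^-1` B) by rewrite -[X in measurable X]setTI; exact: mX.
have c0 : 0 <= fine (Dist k B) by rewrite fine_ge0.
have cE (C : set Omega) :
    mscale (NngNum c0) P C = (Dist k B * P C)%E.
  by rewrite /mscale /= fineK// fin_num_measure.
rewrite muleC -cE; apply: (g_sigma_algebra_measure_unique (other_cylinders k)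
  (@cylinder_measurable k) (fun=> setT) _ _ (mrestr P mXB)) => //.
- move=> _; exists [::], (fun=> setT); split => //.
  by rewrite set_nil bigcap_set0.
- by rewrite bigcup_const//; exists 0%N.
- by move=> C Ck; exact: etrans (cylinder_indep Ck mB) (esym (cE C)).
- move=> _; apply: le_lt_trans (ltry 1).
  by apply: probability_le1; exact: measurableI.
Qed.

(** Rectangles determine the product measure, and on them this is the
    independence of sample k from the others. *)
Lemma law_with_sample k (E : set (others k * S k)) : measurable E ->
  distribution P (@with_sample k) E =
  (distribution P (@to_others k) \x Dist k)%E E.
Proof.
move=> mE; apply/esym/product_measure_unique => // A B mA mB.
by rewrite -others_indep.
Qed.

(** Under the product law Tonelli's theorem integrates over sample k first. *)
Lemma ge0_fresh_expectation k (h : others k * S k -> \bar R) :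
  measurable_fun setT h -> (forall z, 0 <= h z)%E ->
  (\int[P]_w h (w, X k w) = \int[P]_w \int[Dist k]_s h (w, s))%E.
Proof.
move=> mh h0.
transitivity (\int[distribution P (@with_sample k)]_z h z)%E.
  by rewrite ge0_integral_distribution.
transitivity (\int[distribution P (@to_others k) \x Dist k]_z h z)%E.
  by apply: eq_measure_integral => E mE _; exact: law_with_sample.
rewrite fubini_tonelli1// ge0_integral_distribution//.
  exact: measurable_fun_fubini_tonelli_F.
by move=> w; apply: integral_ge0 => s _; exact: h0.
Qed.

Lemma fresh_expectation_eq0 k (h : others k * S k -> \bar R) :
  measurable_fun setT h -> P.-integrable setT (fun w => h (w, X k w)) ->
  (forall w, \int[Dist k]_s h (w, s) = 0)%E ->
  (\int[P]_w h (w, X k w) = 0)%E.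
Proof.
move=> mh ih h0.
have ih' : (distribution P (@with_sample k)).-integrable setT h.
  exact: integrable_pushforward.
transitivity (\int[distribution P (@with_sample k)]_z h z)%E.
  by rewrite integral_distribution.
transitivity (\int[distribution P (@to_others k) \x Dist k]_z h z)%E.
  by apply: eq_measure_integral => E mE _; exact: law_with_sample.
rewrite -integral12_prod_meas1.
  by apply: integral0_eq => w _; exact: h0.
have [_ fin] := integrableP _ _ _ ih'.
apply/integrableP; split => //.
rewrite (_ : integral _ _ _ = \int[distribution P (@with_sample k)]_z `|h z|)%E//.
by apply: eq_measure_integral => E mE _; exact/esym/law_with_sample.
Qed.

End FreshSample.

(** * Square-integrable vectors *)

Section SquareIntegrable.
Context (R : realType) (d : measure_display) (Omega : measurableType d).
Context (P : probability Omega R).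

Notation L1 Z := (P.-integrable setT (EFin \o Z)).

Lemma integrable1D (Z1 Z2 : Omega -> R) : L1 Z1 -> L1 Z2 ->
  L1 (fun w => Z1 w + Z2 w).
Proof. exact: integrableD. Qed.

Lemma integrable1Z a (Z : Omega -> R) : L1 Z -> L1 (fun w => a * Z w).
Proof. by move=> iZ; exact: (integrableZl measurableT a iZ). Qed.

Lemma integrable1_cst a : L1 (fun _ : Omega => a).
Proof. exact: finite_measure_integrable_cst. Qed.

Lemma integrable1_sum (I : Type) (r : seq I) (Q : pred I) (Z : I -> Omega -> R) :
  (forall i, Q i -> L1 (Z i)) -> L1 (fun w => \sum_(i <- r | Q i) Z i w).
Proof.
move=> iZ; have := @integrable_sum _ _ _ P _ measurableT _ r Q (fun i => EFin \o Z i) iZ.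
by congr (integrable _ _ _); apply/funext => w /=; rewrite sumEFin.
Qed.

Lemma Rintegral_sum (I : Type) (r : seq I) (Q : pred I) (Z : I -> Omega -> R) :
  (forall i, Q i -> L1 (Z i)) ->
  \int[P]_w (\sum_(i <- r | Q i) Z i w) = \sum_(i <- r | Q i) \int[P]_w Z i w.
Proof.
move=> iZ; elim: r => [|i r IH].
  under eq_Rintegral do rewrite big_nil.
  by rewrite Rintegral_cst// mul0r big_nil.
under eq_Rintegral do rewrite big_cons.
rewrite big_cons; case: ifP => // Qi.
by rewrite RintegralD// ?IH//; [exact: iZ|exact: integrable1_sum].
Qed.

Lemma EFin_Rintegral (Z : Omega -> R) : L1 Z ->
  ('E_P[Z])%E = (\int[P]_w Z w)%:E.
Proof. by move=> iZ; rewrite unlock fineK//; exact: integrable_fin_num. Qed.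

Implicit Types Z : Omega -> R.

Definition sqint (Z : Omega -> R) : Prop :=
  measurable_fun setT Z /\ L1 (fun w => Z w ^+ 2).

(** The product is dominated by the sum of the squares. *)
Lemma sqint_mul Z1 Z2 : sqint Z1 -> sqint Z2 -> L1 (fun w => Z1 w * Z2 w).
Proof.
move=> [m1 i1] [m2 i2].
apply: (@le_integrable _ _ _ P _ measurableT _
  (EFin \o (fun w => Z1 w ^+ 2 + Z2 w ^+ 2))).
- by apply/measurable_EFinP; exact: measurable_funM.
- move=> w _ /=; rewrite lee_fin (ger0_norm (addr_ge0 (sqr_ge0 _) (sqr_ge0 _))).
  rewrite normrM -(real_normK (num_real (Z1 w))) -(real_normK (num_real (Z2 w))).
  have := sqr_ge0 (`|Z1 w| - `|Z2 w|); have := sqr_ge0 (`|Z1 w|).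
  by have := sqr_ge0 (`|Z2 w|); nra.
- exact: integrable1D.
Qed.

Lemma sqint_le Z1 Z2 : measurable_fun setT Z1 -> L1 Z2 ->
  (forall w, Z1 w ^+ 2 <= Z2 w) -> sqint Z1.
Proof.
move=> m1 i2 le12; split => //; apply: le_integrable i2 => //.
  by apply/measurable_EFinP; exact: measurable_funX.
by move=> w _ /=; rewrite lee_fin (ger0_norm (sqr_ge0 _)) ler_normr le12.
Qed.

Lemma sqintD Z1 Z2 : sqint Z1 -> sqint Z2 -> sqint (fun w => Z1 w + Z2 w).
Proof.
move=> s1 s2; have [m1 i1] := s1; have [m2 i2] := s2.
split; first exact: measurable_funD.
have := integrable1D (integrable1D i1 i2) (integrable1Z 2 (sqint_mul s1 s2)).
by congr (integrable _ _ _); apply/funext => w /=; congr EFin; ring.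
Qed.

Lemma sqintZ a Z : sqint Z -> sqint (fun w => a * Z w).
Proof.
move=> [m i]; split; first exact: measurable_funM.
have := integrable1Z (a ^+ 2) i.
by congr (integrable _ _ _); apply/funext => w /=; congr EFin; ring.
Qed.

Lemma sqint_cst a : sqint (fun=> a).
Proof. by split; [exact: measurable_cst|exact: integrable1_cst]. Qed.

Context (p : nat).

Definition vsqint (U : Omega -> 'rV[R]_p) : Prop :=
  forall j, sqint (fun w => U w 0 j).

Implicit Types U V : Omega -> 'rV[R]_p.

Lemma vsqintD U V : vsqint U -> vsqint V -> vsqint (fun w => U w + V w).
Proof.
move=> sU sV j; have -> : (fun w => (U w + V w) 0 j) = (fun w => U w 0 j + V w 0 j).
  by apply/funext => w; rewrite mxE.
exact: sqintD.
Qed.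

Lemma vsqintZ a U : vsqint U -> vsqint (fun w => a *: U w).
Proof.
move=> sU j; have -> : (fun w => (a *: U w) 0 j) = (fun w => a * U w 0 j).
  by apply/funext => w; rewrite mxE.
exact: sqintZ.
Qed.

Lemma vsqintB U V : vsqint U -> vsqint V -> vsqint (fun w => U w - V w).
Proof.
move=> sU sV; have -> : (fun w => U w - V w) = (fun w => U w + -1 *: V w).
  by apply/funext => w; rewrite scaleN1r.
by apply: vsqintD => //; exact: vsqintZ.
Qed.

Lemma vsqint_cst u : vsqint (fun=> u).
Proof. by move=> j; exact: sqint_cst. Qed.

Lemma vsqint_sum (I : Type) (r : seq I) (Q : pred I) (U : I -> Omega -> 'rV[R]_p) :
  (forall i, Q i -> vsqint (U i)) -> vsqint (fun w => \sum_(i <- r | Q i) U i w).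
Proof.
move=> sU; elim: r => [|i r IH].
  have -> : (fun w => \sum_(i <- [::] | Q i) U i w) = (fun=> 0).
    by apply/funext => w; rewrite big_nil.
  exact: vsqint_cst.
have -> : (fun w => \sum_(j <- i :: r | Q j) U j w) =
    (fun w => if Q i then U i w + \sum_(j <- r | Q j) U j w
              else \sum_(j <- r | Q j) U j w).
  by apply/funext => w; rewrite big_cons.
by case Qi : (Q i) => //; apply: vsqintD => //; exact: sU.
Qed.

Lemma integrable1_dotp U V : vsqint U -> vsqint V ->
  L1 (fun w => dotp (U w) (V w)).
Proof. by move=> sU sV; apply: integrable1_sum => j _; exact: sqint_mul. Qed.

Lemma vsqint_dotp_le (U : Omega -> 'rV[R]_p) Z :
  (forall j, measurable_fun setT (fun w => U w 0 j)) -> L1 Z ->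
  (forall w, dotp (U w) (U w) <= Z w) -> vsqint U.
Proof.
move=> mU iZ UZ j; apply: sqint_le iZ _ => // w; apply: le_trans (UZ w).
rewrite /dotp (bigD1 j)//= expr2 lerDl; apply: sumr_ge0 => i _.
by rewrite -expr2 sqr_ge0.
Qed.

(** The square of a Lipschitz map grows at most quadratically. *)
Lemma vsqint_lipschitz (M : 'rV[R]_p -> 'rV[R]_p) (c : R) U : continuous M ->
  (forall x y, dotp (M x - M y) (M x - M y) <= c * dotp (x - y) (x - y)) ->
  vsqint U -> vsqint (fun w => M (U w)).
Proof.
move=> Mc Mlip sU.
apply: (@vsqint_dotp_le _ (fun w => 2 * (c * dotp (U w) (U w)) + 2 * dotp (M 0) (M 0))).
- move=> j; apply: (measurable_fun_continuous_vec (h := fun x => M x 0 j)).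
    by move=> x; exact: (continuous_comp (Mc x) (@coord_continuous R 1 p 0 j (M x))).
  by move=> i; have [] := sU i.
- apply: integrable1D; last exact: integrable1_cst.
  by do 2!apply: integrable1Z; exact: integrable1_dotp.
- move=> w; rewrite -[M (U w)](subrK (M 0)); apply: le_trans (dotpDD_le _ _) _.
  by rewrite lerD2r ler_pM2l// (le_trans (Mlip _ _))// subr0.
Qed.

End SquareIntegrable.

(** * Orthogonality of the oracle noise *)

Section OracleNoise.
Context (R : realType) (d : measure_display) (Omega : measurableType d).
Context (P : probability Omega R) (I : choiceType) (dS : I -> measure_display).
Context (S : forall k, measurableType (dS k)) (X : forall k, Omega -> S k).
Hypothesis mX : forall k, measurable_fun setT (X k).
Hypothesis indX : mutually_independent P X.
Context (Dist : forall k, probability (S k) R).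
Hypothesis lawX : forall k A, measurable A -> P (X k @^-1` A) = Dist k A.

Notation others k := (g_sigma_algebraType (other_cylinders X k)).

Context (p : nat) (f : I -> 'rV[R]_p -> R) (G : forall k, 'rV[R]_p -> S k -> 'rV[R]_p).
Context (sigma : R) (Y : I -> Omega -> 'rV[R]_p).
Hypothesis gradc : forall k, continuous (grad (f k)).
Hypothesis oracleG : forall k, stochastic_oracle (Dist k) sigma (f k) (@G k).
Hypothesis mY : forall k j,
  measurable_fun setT (fun w : others k => Y k w 0 j).

Definition oracle_error k (x : 'rV[R]_p) (s : S k) : 'rV[R]_p :=
  @G k x s - grad (f k) x.

Definition noise k (w : Omega) : 'rV[R]_p := oracle_error (Y k w) (X k w).

Lemma measurable_oracle k d' (T' : measurableType d') (y : T' -> 'rV[R]_p)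
    (s : T' -> S k) j :
  (forall i, measurable_fun setT (fun w => y w 0 i)) -> measurable_fun setT s ->
  measurable_fun setT (fun w => @G k (y w) (s w) 0 j).
Proof.
move=> my ms; have [mG _ _ _] := oracleG k.
have my' := measurable_vec my.
exact: (measurableT_comp (mG j) (measurable_fun_pair my' ms)).
Qed.

Lemma measurable_oracle_error k d' (T' : measurableType d')
    (y : T' -> 'rV[R]_p) (s : T' -> S k) j :
  (forall i, measurable_fun setT (fun w => y w 0 i)) -> measurable_fun setT s ->
  measurable_fun setT (fun w => oracle_error (y w) (s w) 0 j).
Proof.
move=> my ms.
have -> : (fun w => oracle_error (y w) (s w) 0 j) =
    (fun w => @G k (y w) (s w) 0 j - grad (f k) (y w) 0 j).
  by apply/funext => w; rewrite !mxE.
apply: measurable_funB; first exact: measurable_oracle.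
apply: (measurable_fun_continuous_vec (h := fun x => grad (f k) x 0 j)) => //.
by move=> x; exact: (continuous_comp (@gradc k x) (@coord_continuous R 1 p 0 j _)).
Qed.

Let measurable_dotp d' (T' : measurableType d') (u v : T' -> 'rV[R]_p) :
  (forall j, measurable_fun setT (fun w => u w 0 j)) ->
  (forall j, measurable_fun setT (fun w => v w 0 j)) ->
  measurable_fun setT (fun w => dotp (u w) (v w)).
Proof. by move=> mu mv; apply: measurable_sum => j; exact: measurable_funM. Qed.

Let measurable_fst k (Z : Omega -> 'rV[R]_p) j :
  measurable_fun setT (fun w : others k => Z w 0 j) ->
  measurable_fun setT (fun z : others k * S k => Z z.1 0 j).
Proof. by move=> mZ; exact: (measurableT_comp mZ measurable_fst). Qed.

Let measurable_error k j :
  measurable_fun setT (fun z : others k * S k => oracle_error (Y k z.1) z.2 0 j).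
Proof.
apply: measurable_oracle_error; last exact: measurable_snd.
by move=> i; apply: measurable_fst; exact: mY.
Qed.

Let measurable_noise k j : measurable_fun setT (fun w => noise k w 0 j).
Proof.
apply: measurable_oracle_error; last exact: mX.
by move=> i; apply: (measurable_fun_others mX); exact: mY.
Qed.

Let noise_sq_le k :
  (\int[P]_w (dotp (noise k w) (noise k w))%:E <= (sigma ^+ 2)%:E)%E.
Proof.
pose h (z : others k * S k) : \bar R :=
  (dotp (oracle_error (Y k z.1) z.2) (oracle_error (Y k z.1) z.2))%:E.
rewrite (@ge0_fresh_expectation _ _ _ P _ _ _ X mX indX Dist lawX k h); last 2 first.
- by apply/measurable_EFinP; apply: measurable_dotp; exact: measurable_error.
- by move=> z; rewrite lee_fin dotp_ge0.
have [_ _ _ var] := oracleG k.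
apply: (@le_trans _ _ (\int[P]_w (cst (sigma ^+ 2)%:E w))%E); last first.
  by rewrite integral_cst// [X in (_ * X)%E](probability_setT P) mule1.
apply: ge0_le_integral => //.
- by move=> w _; apply: integral_ge0 => s _; rewrite lee_fin dotp_ge0.
- apply: (measurable_fun_others mX (k := k)).
  apply: (@measurable_fun_fubini_tonelli_F _ _ (others k) (S k) _ _ h).
    by apply/measurable_EFinP; apply: measurable_dotp; exact: measurable_error.
  by move=> z; rewrite lee_fin dotp_ge0.
- move=> w _; apply: le_trans (var (Y k w)); rewrite unlock.
  by under [leRHS]eq_integral do rewrite enorm_sqr.
Qed.

(** The conditional variance bound holds at every base point, hence on average. *)
Lemma vsqint_noise k : vsqint P (noise k).
Proof.
apply: (@vsqint_dotp_le _ _ _ P _ _ (fun w => dotp (noise k w) (noise k w))) => //.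
apply/integrableP; split.
  by apply/measurable_EFinP; apply: measurable_dotp => j; exact: measurable_noise.
apply: le_lt_trans (ltry (sigma ^+ 2)); apply: le_trans (noise_sq_le k).
by under eq_integral do rewrite /= ger0_norm ?dotp_ge0//.
Qed.

Lemma noise_variance k : \int[P]_w dotp (noise k w) (noise k w) <= sigma ^+ 2.
Proof.
rewrite -lee_fin -EFin_Rintegral; last exact/integrable1_dotp/vsqint_noise/vsqint_noise.
by rewrite unlock; exact: noise_sq_le.
Qed.

(** Integrating first over sample k leaves the mean of the oracle error, which is
    zero at every base point. *)
Lemma noise_orthogonal k (Z : Omega -> 'rV[R]_p) :
  (forall j, measurable_fun setT (fun w : others k => Z w 0 j)) -> vsqint P Z ->
  \int[P]_w dotp (Z w) (noise k w) = 0.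
Proof.
move=> mZ sZ.
pose h (z : others k * S k) : \bar R :=
  (dotp (Z z.1) (oracle_error (Y k z.1) z.2))%:E.
have iZ := integrable1_dotp sZ (vsqint_noise k).
rewrite /Rintegral (@fresh_expectation_eq0 _ _ _ P _ _ _ X mX indX Dist lawX k h)//.
  apply/measurable_EFinP; apply: measurable_dotp; last exact: measurable_error.
  by move=> j; apply: measurable_fst.
move=> w; have [_ iG EG _] := oracleG k.
have iGj j : (Dist k).-integrable setT
    (EFin \o (fun s => Z w 0 j * oracle_error (Y k w) s 0 j)).
  apply: integrable1Z.
  have := integrable1D (iG (Y k w) j) (integrable1_cst (Dist k) (- grad (f k) (Y k w) 0 j)).
  by congr (integrable _ _ _); apply/funext => s /=; rewrite !mxE.
transitivity ((\int[Dist k]_s dotp (Z w) (oracle_error (Y k w) s))%:E).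
  by rewrite fineK// integrable_fin_num//; exact: integrable1_sum.
congr EFin; rewrite Rintegral_sum// big1// => j _.
have -> : \int[Dist k]_s (Z w 0 j * oracle_error (Y k w) s 0 j) =
    Z w 0 j * \int[Dist k]_s (@G k (Y k w) s 0 j - grad (f k) (Y k w) 0 j).
  rewrite -RintegralZl//; first by apply: eq_Rintegral => s _; rewrite !mxE.
  exact: integrable1D (iG _ _) (integrable1_cst _ _).
rewrite RintegralB//; [|exact: iG|exact: integrable1_cst].
rewrite Rintegral_cst// [X in fine X](probability_setT (Dist k)) mulr1.
have := EG (Y k w) j; rewrite EFin_Rintegral; last exact: iG.
by move=> [->]; rewrite subrr mulr0.
Qed.

(** The samples are used in some order, so that of any two of them one does not
    enter the noise of the other. *)
Hypothesis order : forall k k', k != k' ->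
  (forall j, measurable_fun setT (fun w : others k => noise k' w 0 j)) \/
  (forall j, measurable_fun setT (fun w : others k' => noise k w 0 j)).

(** Pairwise orthogonality adds the variances. *)
Lemma noise_sum_variance (s : seq I) : uniq s ->
  \int[P]_w dotp (\sum_(k <- s) noise k w) (\sum_(k <- s) noise k w) <=
  (size s)%:R * sigma ^+ 2.
Proof.
have cross k k' : k != k' -> \int[P]_w dotp (noise k w) (noise k' w) = 0.
  move=> kk'; have [m|m] := order kk'.
    under eq_Rintegral do rewrite dotpC.
    by apply: noise_orthogonal => //; exact: vsqint_noise.
  by apply: noise_orthogonal => //; exact: vsqint_noise.
have sN s' : vsqint P (fun w => \sum_(k <- s') noise k w).
  by apply: vsqint_sum => k _; exact: vsqint_noise.
elim: s => [_|k s IH /= /andP[ks us]].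
  under eq_Rintegral do rewrite big_nil dotp0l.
  by rewrite Rintegral_cst// !mul0r.
have dd (u v : 'rV[R]_p) : dotp (u + v) (u + v) = dotp u u + 2 * dotp u v + dotp v v.
  by rewrite dotpDl !dotpDr (dotpC v u); ring.
under eq_Rintegral do rewrite big_cons dd.
have iNN := integrable1_dotp (vsqint_noise k) (vsqint_noise k).
have iNS := integrable1_dotp (vsqint_noise k) (sN s).
have iSS := integrable1_dotp (sN s) (sN s).
rewrite RintegralD//; last exact: (integrable1D iNN (integrable1Z 2 iNS)).
rewrite RintegralD//; last exact: (integrable1Z 2 iNS).
rewrite RintegralZl//.
have -> : \int[P]_w dotp (noise k w) (\sum_(j <- s) noise j w) = 0.
  under eq_Rintegral do rewrite dotp_sumr.
  rewrite Rintegral_sum => [|j _]; last exact/integrable1_dotp/vsqint_noise/vsqint_noise.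
  rewrite big_seq big1// => j js; apply: cross.
  by apply: contraNneq ks => ->.
have := noise_variance k; have := IH us.
by rewrite -natr1; lra.
Qed.

End OracleNoise.

(** * The delayed iteration in expectation *)

Section DelayedSGD.
Context (R : realType) (p n B : nat) (h : 'I_n -> nat).
Context (f : 'I_n -> 'rV[R]_p -> R) (L sigma : R).
Context (dS : 'I_n -> measure_display) (S : forall i, measurableType (dS i)).
Context (Dist : forall i, probability (S i) R).
Context (g : forall i, 'rV[R]_p -> S i -> 'rV[R]_p).
Context (d : measure_display) (Omega : measurableType d) (P : probability Omega R).
Context (xi : forall i, nat -> 'I_B -> {RV P >-> S i}).
Context (gamma : R) (x : nat -> Omega -> 'rV[R]_p) (x0 : 'rV[R]_p).
Hypotheses (B0 : (0 < B)%N) (L0 : 0 < L).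
Hypothesis smf : forall i, Lsmooth L (f i).
Hypothesis oracle : forall i, stochastic_oracle (Dist i) sigma (f i) (@g i).
Hypothesis law : forall i t b (A : set (S i)), measurable A ->
  distribution P (xi i t b) A = Dist i A.
Hypothesis indep : mutually_independent P (S := fun k : 'I_n * nat * 'I_B => S k.1.1)
  (fun k => xi k.1.1 k.1.2 k.2).
Hypothesis x_init : forall w, x 0%N w = x0.
Hypothesis x_step : forall t w, x t.+1 w = x t w - gamma *:
  \sum_(i | (h i <= t)%N)
    @minibatch R p n B S g i (x (t - h i - h i) w) (fun b => xi i (t - h i) b w).

Let I : choiceType := ('I_n * nat * 'I_B)%type.
Let X (k : I) (w : Omega) : S k.1.1 := xi k.1.1 k.1.2 k.2 w.

(** A gradient computed at depth h at time s reaches the root at time s + h, and was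
    evaluated at the root iterate of time s - h. *)
Let used (k : I) : nat := (k.1.2 + h k.1.1)%N.
Let Y (k : I) (w : Omega) : 'rV[R]_p := x (k.1.2 - h k.1.1) w.
Let gk (k : I) := @g k.1.1.

Notation others k := (g_sigma_algebraType (other_cylinders X k)).
Notation zeta k w := (@noise R d Omega I _ _ X p (fun l : I => f l.1.1) gk Y k w).

Let mX (k : I) : measurable_fun setT (X k).
Proof. exact: measurable_funPT. Qed.

Let lawX (k : I) A : measurable A -> P (X k @^-1` A) = Dist k.1.1 A.
Proof. exact: law. Qed.

Let gradc (k : I) : continuous (grad (f k.1.1)).
Proof. by have [_ fc _] := smf k.1.1. Qed.

Let oracleX (k : I) : stochastic_oracle (Dist k.1.1) sigma (f k.1.1) (@gk k).
Proof. exact: oracle. Qed.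

(** The iterate of time t is a function of the samples used before time t, none
    of which is k if k is used at time t or later. *)
Let x_others (k : I) t j : (t <= used k)%N ->
  measurable_fun setT (fun w : others k => x t w 0 j).
Proof.
elim/ltn_ind: t j => -[|t] IH j tk.
  have -> : (fun w : others k => x 0 w 0 j) = cst (x0 0 j).
    by apply/funext => w; rewrite x_init.
  exact: measurable_cst.
have -> : (fun w => x t.+1 w 0 j) = (fun w => x t w 0 j - gamma *
    \sum_i (if (h i <= t)%N then B%:R^-1 * \sum_(b < B)
      g (x (t - h i - h i) w) (xi i (t - h i) b w) 0 j else 0)).
  apply/funext => w; rewrite x_step !mxE summxE big_mkcond /=.
  congr (_ - _ * _); apply: eq_bigr => i _; case: ifP => // _.
  by rewrite mxE summxE.
apply: measurable_funB; first by apply: IH => //; exact: ltnW.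
apply: measurable_funM; first exact: measurable_cst.
apply: measurable_sum => i; have [hi|_] := leqP (h i) t; last exact: measurable_cst.
apply: measurable_funM; first exact: measurable_cst.
apply: measurable_sum => b.
pose k' : I := (i, t - h i, b)%N.
apply: (@measurable_oracle R I _ (fun k : I => S k.1.1) _ p (fun k : I => f k.1.1) gk sigma oracleX k' _ (others k) (x (t - h i - h i)%N) (X k') j).
  by move=> c; apply: IH => //; rewrite ?ltnS; lia.
apply: measurable_others; apply/eqP => kE.
by move: tk; rewrite -kE /used /= subnK// ltnn.
Qed.

Let Y_others (k : I) j : measurable_fun setT (fun w : others k => Y k w 0 j).
Proof. by apply: x_others; rewrite /used; lia. Qed.

Let zeta_others (k k' : I) j : k' != k -> (used k' <= used k)%N ->
  measurable_fun setT (fun w : others k => zeta k' w 0 j).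
Proof.
move=> kk' uk.
apply: (measurable_oracle_error (S := fun k : I => S k.1.1) gradc oracleX).
  by move=> i; apply: x_others; apply: leq_trans uk; rewrite /used; lia.
exact: measurable_others.
Qed.

Let zeta_order (k k' : I) : k != k' ->
  (forall j, measurable_fun setT (fun w : others k => zeta k' w 0 j)) \/
  (forall j, measurable_fun setT (fun w : others k' => zeta k w 0 j)).
Proof.
move=> kk'; have [uk|/ltnW uk] := leqP (used k') (used k); [left|right] => j.
  by apply: zeta_others; rewrite // eq_sym.
exact: zeta_others.
Qed.

Let vsqint_zeta k : vsqint P (fun w => zeta k w).
Proof. exact: (vsqint_noise mX indep lawX gradc oracleX Y_others). Qed.


Let gr i := grad (f i).
Let v t w := delayed_grad h gr (fun s => x s w) t.

(** The oracle noise entering the step from time t to time t + 1. *)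
Let e t (w : Omega) : 'rV[R]_p :=
  B%:R^-1 *: \sum_(i | (h i <= t)%N) \sum_(b < B) zeta ((i, t - h i, b)%N : I) w.

Let BR : B%:R != 0 :> R. Proof. by rewrite pnatr_eq0 -lt0n. Qed.

Let x_step_noise t w : x t.+1 w = x t w - gamma *: (v t w + e t w).
Proof.
rewrite x_step; congr (_ - _ *: _).
rewrite /v /delayed_grad /e scaler_sumr -big_split /=; apply: eq_bigr => i _.
rewrite /minibatch /noise /oracle_error /Y /= sumrB sumr_const card_ord.
by rewrite -[X in _ *: (_ - X)]scaler_nat scalerBr scalerA mulVf// scale1r addrC subrK.
Qed.

Let vsqint_e t : vsqint P (e t).
Proof.
apply: vsqintZ; apply: vsqint_sum => i _; apply: vsqint_sum => b _.
exact: vsqint_zeta.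
Qed.

Let vsqint_gr i U : vsqint P U -> vsqint P (fun w => gr i (U w)).
Proof.
move=> sU; have [_ fc _] := smf i.
exact: vsqint_lipschitz fc (Lsmooth_dotp L0 (smf i)) sU.
Qed.

Let vsqint_v_of t : (forall s, (s <= t)%N -> vsqint P (x s)) -> vsqint P (v t).
Proof.
move=> sx; rewrite /v /delayed_grad; apply: vsqint_sum => i _.
by apply: vsqint_gr; apply: sx; lia.
Qed.

Let vsqint_x t : vsqint P (x t).
Proof.
elim/ltn_ind: t => -[|t] IH.
  by rewrite (_ : x 0%N = fun=> x0); [exact: vsqint_cst|exact/funext].
rewrite (_ : x t.+1 = fun w => x t w - gamma *: (v t w + e t w)); last first.
  by apply/funext => w; exact: x_step_noise.
apply: vsqintB; first exact: IH.
apply: vsqintZ; apply: vsqintD => //; apply: vsqint_v_of => s st; exact: IH.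
Qed.

Let vsqint_v t : vsqint P (v t).
Proof. by apply: vsqint_v_of => s _; exact: vsqint_x. Qed.

Let vsqint_gF t : vsqint P (fun w => grad (avg_fun f) (x t w)).
Proof.
under eq_fun do rewrite (grad_avg_fun smf).
by apply: vsqintZ; apply: vsqint_sum => i _; apply: vsqint_gr.
Qed.

(** The samples whose noise enters the steps taken during [a, t). *)
Let window a t : seq I :=
  [seq (q.1.2, q.1.1 - h q.1.2, q.2)%N |
    q <- [seq (r, b) | r <- [seq (s, i) | s <- index_iota a t, i <- enum 'I_n],
                       b <- enum 'I_B] & (h q.1.2 <= q.1.1)%N].

(** The agent and its depth recover the time of use from the time of drawing, so
    no sample is counted twice. *)
Let window_uniq a t : uniq (window a t).
Proof.
rewrite map_inj_in_uniq.
  apply: filter_uniq; apply: allpairs_uniq; [|exact: enum_uniq|by move=> [? ?] [? ?]].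
  apply: allpairs_uniq; [exact: iota_uniq|exact: enum_uniq|by move=> [? ?] [? ?]].
move=> [[s i] b] [[s' i'] b']; rewrite !mem_filter /= => /andP[hs _] /andP[hs' _].
by move=> [ii ss bb]; move: hs' ss; rewrite -ii -bb => hs' ss; congr (_, _, _); lia.
Qed.

Let window_size a t : (size (window a t) <= (t - a) * n * B)%N.
Proof.
rewrite size_map size_filter; apply: leq_trans (count_size _ _) _.
by rewrite !size_allpairs size_iota !size_enum_ord.
Qed.

Let window_sum a t w :
  \sum_(a <= s < t) e s w = B%:R^-1 *: \sum_(k <- window a t) zeta k w.
Proof.
rewrite big_map big_filter [in RHS]big_mkcond big_allpairs big_allpairs /= -scaler_sumr.
congr (_ *: _); apply: eq_bigr => s _.
rewrite big_enum [LHS]big_mkcond /=; apply: eq_bigr => i _.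
by rewrite big_enum; case: ifP => // _; rewrite big1.
Qed.

Let window_variance a t :
  \int[P]_w dotp (\sum_(a <= s < t) e s w) (\sum_(a <= s < t) e s w) <=
  (t - a)%:R * n%:R * sigma ^+ 2 / B%:R.
Proof.
under eq_Rintegral do rewrite window_sum dotpZl dotpZr mulrA.
rewrite RintegralZl//; last first.
  by apply: integrable1_dotp; apply: vsqint_sum => k _; exact: vsqint_zeta.
have := noise_sum_variance mX indep lawX gradc oracleX Y_others zeta_order (window_uniq a t).
set E := Rintegral _ _ _ => EN.
have {EN} : E <= ((t - a) * n * B)%:R * sigma ^+ 2.
  by apply: le_trans EN _; rewrite ler_wpM2r ?sqr_ge0 ?ler_nat.
have B2 : 0 <= B%:R^-1 * B%:R^-1 :> R by rewrite mulr_ge0.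
move=> /(ler_wpM2l B2) /le_trans; apply.
by rewrite le_eqVlt; apply/orP; left; apply/eqP; rewrite !natrM; field.
Qed.

Let gF z := grad (avg_fun f) z.
(** The coefficient of the noise in the descent inequality. *)
Let Z t w : 'rV[R]_p := (L * gamma ^+ 2) *: v t w - gamma *: gF (x t w).

Let gr_others (k : I) i s j : (s <= used k)%N ->
  measurable_fun setT (fun w : others k => gr i (x s w) 0 j).
Proof.
move=> sk; have [_ fc _] := smf i.
apply: (measurable_fun_continuous_vec (h := fun z => gr i z 0 j)).
  by move=> z; exact: (continuous_comp (fc z) (@coord_continuous R 1 p 0 j _)).
by move=> c; exact: x_others.
Qed.

Let Z_others (k : I) t j : used k = t ->
  measurable_fun setT (fun w : others k => Z t w 0 j).
Proof.
move=> kt.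
have -> : (fun w => Z t w 0 j) = (fun w => L * gamma ^+ 2 *
    \sum_i (if (h i <= t)%N then gr i (x (t - h i - h i) w) 0 j else 0) -
    gamma * (n%:R^-1 * \sum_i gr i (x t w) 0 j)).
  apply/funext => w; rewrite /Z /gF (grad_avg_fun smf) !mxE !summxE.
  by congr (_ * _ - _); rewrite [LHS]big_mkcond; apply: eq_bigr => i _; case: ifP.
apply: measurable_funB; apply: measurable_funM; try exact: measurable_cst.
  apply: measurable_sum => i; case: (h i <= t)%N; last exact: measurable_cst.
  by apply: gr_others; lia.
apply: measurable_funM; first exact: measurable_cst.
by apply: measurable_sum => i; apply: gr_others; rewrite kt.
Qed.

Let vsqint_Z t : vsqint P (Z t).
Proof. by apply: vsqintB; apply: vsqintZ. Qed.

(** The samples in e_t are used at time t, after Z_t is determined. *)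
Let e_orthogonal t : \int[P]_w dotp (Z t w) (e t w) = 0.
Proof.
under eq_Rintegral do rewrite /e dotpZr dotp_sumr.
have iZ i b : P.-integrable setT
    (EFin \o (fun w => dotp (Z t w) (zeta ((i, t - h i, b)%N : I) w))).
  exact: integrable1_dotp.
have iZi i : P.-integrable setT (EFin \o (fun w =>
    dotp (Z t w) (\sum_(b < B) zeta ((i, t - h i, b)%N : I) w))).
  by apply: integrable1_dotp => //; exact: vsqint_sum.
rewrite RintegralZl//; last exact: integrable1_sum.
rewrite Rintegral_sum// big1 ?mulr0// => i hi.
under eq_Rintegral do rewrite dotp_sumr.
rewrite Rintegral_sum// big1// => b _.
apply: (noise_orthogonal mX indep lawX gradc oracleX Y_others) => // j.
by apply: Z_others; rewrite /used /= subnK.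
Qed.

Lemma integrable_stationarity t :
  P.-integrable setT (EFin \o (fun w => enorm (grad (avg_fun f) (x t w)) ^+ 2)).
Proof.
have := integrable1_dotp (vsqint_gF t) (vsqint_gF t).
by congr (integrable _ _ _); apply/funext => w /=; rewrite enorm_sqr.
Qed.

Context (D : nat) (low : R).
Hypotheses (n0 : (0 < n)%N) (D0 : (0 < D)%N) (hD : forall i, (h i <= D)%N).
Hypotheses (gamma0 : 0 < gamma) (gamma_small : 40 * n%:R * D%:R * L * gamma <= 1).
Hypothesis f_low : forall z, low <= avg_fun f z.

Lemma delayed_sgd_expectation (T : nat) :
  gamma * n%:R / 2 *
    \sum_(0 <= t < T) \int[P]_w (enorm (grad (avg_fun f) (x t w)) ^+ 2) <=
  avg_fun f x0 - low +
  gamma / n%:R * (\sum_i (h i)%:R) * (\sum_i enorm (grad (f i) x0) ^+ 2) +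
  T%:R * (L * gamma ^+ 2 / 2 + 4 * gamma ^+ 3 * L ^+ 2 * n%:R * D%:R) *
    (n%:R * sigma ^+ 2 / B%:R).
Proof.
pose W t i w := \sum_(t - (h i).*2 <= s < t) e s w.
have iF t : P.-integrable setT (EFin \o (fun w => dotp (gF (x t w)) (gF (x t w)))).
  by apply: integrable1_dotp; exact: vsqint_gF.
have ie t : P.-integrable setT (EFin \o (fun w => dotp (e t w) (e t w))).
  exact: integrable1_dotp.
have iZe t : P.-integrable setT (EFin \o (fun w => dotp (Z t w) (e t w))).
  exact: integrable1_dotp.
have iW t i : P.-integrable setT (EFin \o (fun w => dotp (W t i w) (W t i w))).
  by apply: integrable1_dotp; exact: vsqint_sum.
pose A := avg_fun f x0 - low +
  gamma / n%:R * (\sum_i (h i)%:R) * (\sum_i enorm (grad (f i) x0) ^+ 2).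
pose lhs w := gamma * n%:R / 2 * \sum_(0 <= t < T) dotp (gF (x t w)) (gF (x t w)).
pose r1 w := \sum_(0 <= t < T)
  (dotp (Z t w) (e t w) + L * gamma ^+ 2 / 2 * dotp (e t w) (e t w)).
pose r2 w := \sum_(0 <= t < T) \sum_i dotp (W t i w) (W t i w).
pose c := 2 * gamma ^+ 3 * L ^+ 2.
have path w : lhs w <= A + r1 w + c * r2 w.
  have := @delayed_descent R p n h D (avg_fun f) gF gr L gamma low
    (fun t => x t w) (fun t => e t w) n0 D0 hD L0 gamma0 gamma_small
    (grad_avg_fun smf) (fun i => Lsmooth_dotp L0 (smf i)) (descent_avg_fun L0 smf)
    f_low (fun t => x_step_noise t w) T.
  rewrite /lhs /r1 /r2 /c /A x_init.
  by under [\sum_i enorm _ ^+ 2]eq_bigr do rewrite enorm_sqr.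
have ilhs : P.-integrable setT (EFin \o lhs).
  by apply: integrable1Z; exact: integrable1_sum.
have ir1t t : P.-integrable setT (EFin \o (fun w =>
    dotp (Z t w) (e t w) + L * gamma ^+ 2 / 2 * dotp (e t w) (e t w))).
  by apply: integrable1D => //; exact: integrable1Z.
have ir1 : P.-integrable setT (EFin \o r1) by exact: integrable1_sum.
have ir2t t : P.-integrable setT (EFin \o (fun w => \sum_i dotp (W t i w) (W t i w))).
  exact: integrable1_sum.
have ir2 : P.-integrable setT (EFin \o r2) by exact: integrable1_sum.
have icr2 := integrable1Z c ir2.
have iA := integrable1_cst P A.
have iAr1 := integrable1D iA ir1.
have := le_Rintegral measurableT ilhs (integrable1D iAr1 icr2) (fun w _ => path w).
rewrite RintegralZl// ?Rintegral_sum//; last exact: integrable1_sum.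
rewrite RintegralD// RintegralD// RintegralZl// Rintegral_cst//.
rewrite [X in fine X](probability_setT P) mulr1.
pose V := n%:R * sigma ^+ 2 / B%:R.
have V0 : 0 <= V.
  by apply: divr_ge0 => //; apply: mulr_ge0 => //; exact: sqr_ge0.
have eV t : \int[P]_w dotp (e t w) (e t w) <= V.
  have := window_variance t t.+1; rewrite subSnn mul1r.
  by under eq_Rintegral do rewrite big_nat1.
have WV t i : \int[P]_w dotp (W t i w) (W t i w) <= 2 * D%:R * V.
  apply: le_trans (window_variance _ _) _.
  have -> : (t - (t - (h i).*2))%:R * n%:R * sigma ^+ 2 / B%:R =
    (t - (t - (h i).*2))%:R * V by rewrite /V; ring.
  apply: ler_wpM2r => //; rewrite -natrM ler_nat mul2n.
  by apply: (@leq_trans (h i).*2); rewrite ?leq_double// leq_subLR addnC -leq_subLR.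
have constT (z : R) : T%:R * z = \sum_(0 <= t < T) z.
  by rewrite sumr_const_nat subn0 mulr_natl.
have r1V : \int[P]_w r1 w <= T%:R * (L * gamma ^+ 2 / 2 * V).
  rewrite Rintegral_sum// constT.
  apply: ler_sum => t _.
  rewrite RintegralD//; last exact: integrable1Z.
  rewrite e_orthogonal add0r RintegralZl//; apply: ler_wpM2l => //.
  by rewrite !mulr_ge0 ?sqr_ge0// ltW.
have r2V : \int[P]_w r2 w <= T%:R * (n%:R * (2 * D%:R * V)).
  rewrite Rintegral_sum// constT.
  apply: ler_sum => t _; rewrite Rintegral_sum// mulr_natl.
  apply: le_trans (ler_sum _ (fun i _ => WV t i)) _.
  by rewrite sumr_const card_ord.
have c0 : 0 <= c by rewrite /c !mulr_ge0 ?sqr_ge0 ?exprn_ge0// ltW.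
have cr2V := ler_wpM2l c0 r2V.
under [in X in _ -> X]eq_bigr do under eq_Rintegral do rewrite enorm_sqr.
rewrite -/V -/A => main; apply: le_trans main _; move: r1V cr2V; rewrite /c.
by set S1 := Rintegral _ _ r1; set S2 := Rintegral _ _ r2; lra.
Qed.

End DelayedSGD.

(** * The choice of the stepsize *)

Section StepsizeChoice.
Context (R : realType) (n B D T : nat) (L sigma Delta K : R).
Hypotheses (n0 : (0 < n)%N) (B0 : (0 < B)%N) (D0 : (0 < D)%N) (T0 : (0 < T)%N).
Hypotheses (L0 : 0 < L) (sigma0 : 0 < sigma) (Delta0 : 0 < Delta) (K0 : 0 <= K).

Let gamma1 := Num.sqrt (B%:R * Delta) / Num.sqrt (n%:R * T%:R * L * sigma ^+ 2).
Let gamma2 : R := 1 / (40 * n%:R * D%:R * L).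
Let rate := Num.sqrt (Delta * L * sigma ^+ 2) / Num.sqrt (n%:R * B%:R * T%:R).

Let nR : 0 < n%:R :> R. Proof. by rewrite ltr0n. Qed.
Let BR : 0 < B%:R :> R. Proof. by rewrite ltr0n. Qed.
Let DR : 0 < D%:R :> R. Proof. by rewrite ltr0n. Qed.
Let TR : 0 < T%:R :> R. Proof. by rewrite ltr0n. Qed.

Let gamma1_gt0 : 0 < gamma1.
Proof. by rewrite divr_gt0// sqrtr_gt0 !mulr_gt0// exprn_gt0. Qed.

Let gamma2_gt0 : 0 < gamma2.
Proof. by rewrite divr_gt0// !mulr_gt0. Qed.

Let rate_ge0 : 0 <= rate.
Proof. by rewrite divr_ge0// sqrtr_ge0. Qed.

(** The first stepsize balances the initial gap against the noise. *)
Let rate_gap : Delta / (n%:R * T%:R * gamma1) = rate /\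
  L * gamma1 * sigma ^+ 2 / B%:R = rate.
Proof.
rewrite /gamma1 /rate; have : 0 < sigma ^+ 2 by rewrite exprn_gt0.
move: (sigma ^+ 2) => v v0; rewrite !sqrtrM ?mulr_ge0 ?ltW//.
have sq (z : R) : 0 < z -> exists2 r, 0 < r & z = r ^+ 2 /\ Num.sqrt z = r.
  by move=> z0; exists (Num.sqrt z); rewrite ?sqrtr_gt0// sqr_sqrtr// ltW.
have [b b0 [-> ->]] := sq _ BR; have [m m0 [-> ->]] := sq _ nR.
have [l l0 [-> ->]] := sq _ L0; have [t t0 [-> ->]] := sq _ TR.
have [c c0 [-> ->]] := sq _ Delta0; have [r r0 [-> ->]] := sq _ v0.
by split; field; rewrite !gt_eqF.
Qed.

Definition stepsize : R := Num.min gamma1 gamma2.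

Lemma stepsize_gt0 : 0 < stepsize.
Proof. by rewrite lt_min gamma1_gt0. Qed.

Lemma stepsize_small : 40 * n%:R * D%:R * L * stepsize <= 1.
Proof.
have c0 : 0 < 40 * n%:R * D%:R * L by rewrite !mulr_gt0.
by rewrite mulrC -ler_pdivlMr// /stepsize ge_min lexx orbT.
Qed.

(** The inverse of a minimum is at most the sum of the inverses: one stepsize
    gives the noise rate, the other one the delay term. *)
Lemma stepsize_rate (a : R) :
  stepsize * n%:R / 2 * (T%:R * a) <= Delta + stepsize * n%:R * K +
    T%:R * (L * stepsize ^+ 2 / 2 + 4 * stepsize ^+ 3 * L ^+ 2 * n%:R * D%:R) *
    (n%:R * sigma ^+ 2 / B%:R) ->
  a <= 60 * Num.sqrt (Delta * L * sigma ^+ 2) / Num.sqrt (n%:R * B%:R * T%:R) +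
    400 * D%:R * Delta * L / T%:R + 50 * K / T%:R.
Proof.
have s0 := stepsize_gt0; have small := stepsize_small.
set s := stepsize in s0 small * => main.
have c0 : 0 < s * n%:R / 2 * T%:R by rewrite !mulr_gt0.
have {main} : a <= 2 * Delta / (n%:R * T%:R) * s^-1 + 2 * K / T%:R +
    (L * s + 8 * s ^+ 2 * L ^+ 2 * n%:R * D%:R) * (sigma ^+ 2 / B%:R).
  rewrite -(ler_pM2l c0) -[leLHS]mulrA; apply: le_trans main _.
  by rewrite le_eqVlt; apply/orP; left; apply/eqP; field; rewrite !gt_eqF.
have sinv : s^-1 <= gamma1^-1 + gamma2^-1.
  by rewrite /s /stepsize minEle; case: ifP => _; rewrite ?lerDl ?lerDr invr_ge0 ltW.
have sg1 : s <= gamma1 by rewrite /s /stepsize ge_min lexx.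
have gap : 2 * Delta / (n%:R * T%:R) * s^-1 <= 2 * rate + 80 * (D%:R * Delta * L / T%:R).
  have d0 : 0 <= 2 * Delta / (n%:R * T%:R) by rewrite ltW// divr_gt0 ?mulr_gt0.
  apply: le_trans (ler_wpM2l d0 sinv) _.
  rewrite -rate_gap.1 /gamma2 le_eqVlt; apply/orP; left; apply/eqP; field.
  by rewrite !gt_eqF.
have noise : (L * s + 8 * s ^+ 2 * L ^+ 2 * n%:R * D%:R) * (sigma ^+ 2 / B%:R) <= 2 * rate.
  have v0 : 0 <= sigma ^+ 2 / B%:R by rewrite divr_ge0 ?sqr_ge0 ?ltW.
  have -> : 2 * rate = 2 * (L * gamma1) * (sigma ^+ 2 / B%:R).
    by rewrite -rate_gap.2; ring.
  apply: ler_wpM2r => //.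
  have Ls0 : 0 < L * s by rewrite mulr_gt0.
  have : L * s <= L * gamma1 by rewrite ler_pM2l.
  have : (L * s) * (40 * n%:R * D%:R * L * s) <= (L * s) * 1 by rewrite ler_pM2l.
  by lra.
have DT0 : 0 <= D%:R * Delta * L / T%:R by rewrite ltW// divr_gt0 ?mulr_gt0.
have KT0 : 0 <= K / T%:R by exact: divr_ge0 K0 (ltW TR).
have -> : 60 * Num.sqrt (Delta * L * sigma ^+ 2) / Num.sqrt (n%:R * B%:R * T%:R) = 60 * rate.
  by rewrite /rate mulrA.
have -> : 400 * D%:R * Delta * L / T%:R = 400 * (D%:R * Delta * L / T%:R) by ring.
have -> : 50 * K / T%:R = 50 * (K / T%:R) by ring.
have -> : 2 * K / T%:R = 2 * (K / T%:R) by ring.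
have := rate_ge0; lra.
Qed.

(** The two terms of T make the noise rate and the bias at most eps^2 / 2 each. *)
Lemma rate_le_eps (eps : R) : 0 < eps ->
  120 ^+ 2 * Delta * L * sigma ^+ 2 / (n%:R * B%:R * eps ^+ 4) +
    (800 * D%:R * Delta * L + 100 * K) / eps ^+ 2 <= T%:R ->
  60 * Num.sqrt (Delta * L * sigma ^+ 2) / Num.sqrt (n%:R * B%:R * T%:R) +
    400 * D%:R * Delta * L / T%:R + 50 * K / T%:R <= eps ^+ 2.
Proof.
move=> eps0 TA.
have e2 : 0 < eps ^+ 2 by rewrite exprn_gt0.
have e4 : 0 < eps ^+ 4 by rewrite exprn_gt0.
have v0 : 0 < Delta * L * sigma ^+ 2 by rewrite !mulr_gt0// exprn_gt0.
have nB0 : 0 < n%:R * B%:R :> R by rewrite mulr_gt0.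
have bias0 : 0 <= (800 * D%:R * Delta * L + 100 * K) / eps ^+ 2.
  have DL0 : 0 < D%:R * Delta * L by rewrite !mulr_gt0.
  by apply: divr_ge0; [have := K0; lra|exact: ltW].
have noise0 : 0 <= 120 ^+ 2 * Delta * L * sigma ^+ 2 / (n%:R * B%:R * eps ^+ 4).
  by apply: divr_ge0; [lra|exact/ltW/mulr_gt0].
have noise : 60 * Num.sqrt (Delta * L * sigma ^+ 2) / Num.sqrt (n%:R * B%:R * T%:R) <=
    eps ^+ 2 / 2.
  have s0 : 0 < Num.sqrt (n%:R * B%:R * T%:R) :> R by rewrite sqrtr_gt0 mulr_gt0.
  rewrite ler_pdivrMr//.
  suff : 120 * Num.sqrt (Delta * L * sigma ^+ 2) <=
      eps ^+ 2 * Num.sqrt (n%:R * B%:R * T%:R) by lra.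
  have vs := sqrtr_ge0 (Delta * L * sigma ^+ 2).
  rewrite -ler_sqr ?nnegrE; [|exact: mulr_ge0|exact/ltW/mulr_gt0].
  rewrite [leLHS]exprMn [leRHS]exprMn (sqr_sqrtr (ltW v0)).
  rewrite (sqr_sqrtr (ltW (mulr_gt0 nB0 TR))).
  have : 120 ^+ 2 * Delta * L * sigma ^+ 2 / (n%:R * B%:R * eps ^+ 4) <= T%:R by lra.
  rewrite ler_pdivrMr ?mulr_gt0// => h.
  have -> : (eps ^+ 2) ^+ 2 * (n%:R * B%:R * T%:R) = T%:R * (n%:R * B%:R * eps ^+ 4) by ring.
  by apply: le_trans h; rewrite le_eqVlt; apply/orP; left; apply/eqP; ring.
have bias : 400 * D%:R * Delta * L / T%:R + 50 * K / T%:R <= eps ^+ 2 / 2.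
  rewrite -mulrDl ler_pdivrMr//.
  have : (800 * D%:R * Delta * L + 100 * K) / eps ^+ 2 <= T%:R by lra.
  by rewrite ler_pdivrMr//; lra.
by rewrite -addrA; lra.
Qed.

End StepsizeChoice.

(** * The convergence rate of Tree-RGT *)

Theorem corollary4p3 (R : realType) (p n B : nat)
  (* communication graph, with node 0 as the prescribed root *)
  (hn : (2 <= n)%N) (hB : (1 <= B)%N)
  (G : rel 'I_n) (Gsym : symmetric G) (Gconn : forall i j, connect G i j)
  (root : 'I_n) (hroot : nat_of_ord root = 0%N)
  (* objectives *)
  (f : 'I_n -> 'rV[R]_p -> R) (L : R) (hL : 0 < L)
  (hf : forall i, Lsmooth L (f i))
  (hfinf : has_lbound (range (avg_fun f)))
  (* stochastic oracles *)
  (sigma : R) (hsigma : 0 < sigma)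
  (dS : 'I_n -> measure_display) (S : forall i, measurableType (dS i))
  (Dist : forall i, probability (S i) R)
  (g : forall i, 'rV[R]_p -> S i -> 'rV[R]_p)
  (hg : forall i, stochastic_oracle (Dist i) sigma (f i) (g i))
  (* samples xi i t b : agent i, time t, oracle call b of the mini-batch *)
  (d : measure_display) (Omega : measurableType d) (P : probability Omega R)
  (xi : forall i, nat -> 'I_B -> {RV P >-> S i})
  (hlaw : forall i t b (A : set (S i)), measurable A ->
     distribution P (xi i t b) A = Dist i A)
  (hind : mutually_independent P (S := fun k : 'I_n * nat * 'I_B => S k.1.1)
     (fun k => xi k.1.1 k.1.2 k.2))
  (x0 : 'rV[R]_p) :
  let D : R := (max_depth G root)%:R in
  let Davg : R := avg_depth G root R in
  let Delta : R := avg_fun f x0 - inf (range (avg_fun f)) in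
  let H0 : R := n%:R^-1 * \sum_i enorm (grad (f i) x0) ^+ 2 in
  let gammaB (T : nat) : R :=
    Num.min (Num.sqrt (B%:R * Delta) /
             Num.sqrt (n%:R * T%:R * L * sigma ^+ 2))
            (1 / (40 * n%:R * D * L)) in
  let avg_sq_grad (T : nat) : \bar R :=
    root_stationarity G root f g P xi x0 (gammaB T) T in
  0 < Delta ->
  (forall T : nat, (1 <= T)%N ->
     (avg_sq_grad T <=
      (60 * Num.sqrt (Delta * L * sigma ^+ 2) / Num.sqrt (n%:R * B%:R * T%:R) +
       400 * D * Delta * L / T%:R + 50 * Davg * H0 / T%:R)%:E)%E) /\
  (forall eps : R, 0 < eps ->
     let T : nat :=
       `|Num.ceil (14400 * Delta * L * sigma ^+ 2 / (n%:R * B%:R * eps ^+ 4) +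
                   (800 * D * Delta * L + 100 * Davg * H0) / eps ^+ 2)|%N in
     (avg_sq_grad T <= (eps ^+ 2)%:E)%E).
Proof.
move=> D Davg Delta H0 gammaB avg_sq_grad Delta_gt0.
have n0 : (0 < n)%N by exact: ltnW.
have nR : n%:R != 0 :> R by rewrite pnatr_eq0 -lt0n.
have Dgt0 : (0 < max_depth G root)%N by exact: max_depth_gt0.
pose K := Davg * H0.
have K0 : 0 <= K.
  apply: mulr_ge0; apply: mulr_ge0; rewrite ?invr_ge0//; apply: sumr_ge0 => // i _.
  exact: sqr_ge0.
have f_low z : inf (range (avg_fun f)) <= avg_fun f z.
  by apply: ge_inf => //; exists z.
have main (T : nat) : (1 <= T)%N -> exists2 a : R, avg_sq_grad T = a%:E &
    a <= 60 * Num.sqrt (Delta * L * sigma ^+ 2) / Num.sqrt (n%:R * B%:R * T%:R) +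
      400 * D * Delta * L / T%:R + 50 * K / T%:R.
  move=> T0; pose gamma := stepsize n B (max_depth G root) T L sigma Delta.
  have gammaE : gammaB T = gamma by [].
  pose x t w := (tree_rgt G root (@minibatch R p n B S g) gamma x0
    (fun i s b => xi i s b w) t).1 root.
  have gamma0 : 0 < gamma by exact: stepsize_gt0.
  have small : 40 * n%:R * (max_depth G root)%:R * L * gamma <= 1.
    exact: stepsize_small.
  have x_step t w : x t.+1 w = x t w - gamma *:
      \sum_(i | (depth G root i <= t)%N)
        @minibatch R p n B S g i (x (t - depth G root i - depth G root i)%N w)
          (fun b => xi i (t - depth G root i)%N b w).
    exact: tree_rgt_root_step.
  have x_init w : x 0%N w = x0 by [].
  have bound := delayed_sgd_expectation hB hL hf hg hlaw hind x_init x_step n0 Dgt0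
    (depth_le_max G root) gamma0 small f_low T.
  have iE t : P.-integrable setT
      (EFin \o (fun w => enorm (grad (avg_fun f) (x t w)) ^+ 2)).
    exact: (integrable_stationarity hB hL hf hg hlaw hind x_init x_step).
  exists (T%:R^-1 *
    \sum_(0 <= t < T) \int[P]_w (enorm (grad (avg_fun f) (x t w)) ^+ 2)).
    rewrite /avg_sq_grad /root_stationarity gammaE EFinM -sumEFin.
    by congr (_ * _)%E; apply: eq_bigr => t _; exact: (EFin_Rintegral (iE t)).
  have TR : T%:R != 0 :> R by rewrite pnatr_eq0 -lt0n.
  apply: stepsize_rate => //; rewrite -/gamma [X in _ * X <= _]mulrA mulfV// mul1r.
  apply: le_trans bound _; rewrite -/Delta -/D le_eqVlt; apply/orP; left; apply/eqP.
  congr (_ + _ + _); rewrite /K /Davg /avg_depth /H0.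
  by field.
split => [T T0|eps eps0].
  have [a -> aT] := main T T0; rewrite lee_fin; apply: le_trans aT _.
  by rewrite /K mulrA.
have -> : 14400 = 120 ^+ 2 :> R by rewrite -natrX; congr (_%:R).
have -> : 100 * Davg * H0 = 100 * K by rewrite /K mulrA.
set A := 120 ^+ 2 * _ * _ * _ / _ + _; set T := `|Num.ceil A|%N => /=.
have A0 : 0 < A.
  have DL : 0 < Delta * L by rewrite mulr_gt0.
  have D0 : 0 <= D * (Delta * L) by rewrite mulr_ge0// ltW.
  apply: ltr_wpDr; first by apply: divr_ge0; [lra|exact: sqr_ge0].
  rewrite !divr_gt0 ?mulr_gt0 ?exprn_gt0// ltr0n//; exact: ltnW.
have AT : A <= T%:R.
  rewrite /T natr_absz ger0_norm; first exact: ceil_ge.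
  by rewrite ceil_ge0; apply: lt_trans A0; rewrite ltrN10.
have T0 : (1 <= T)%N by rewrite -(ltr0n R); exact: lt_le_trans AT.
have [a -> aT] := main T T0; rewrite lee_fin; apply: le_trans aT _.
exact: rate_le_eps.
Qed.
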